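(* Let $L$ be a differential graded Lie algebra over $\mathbb{Q}$ with homology $H=H(L)$, let $k\ge 2$, and let $x_1,\dots,x_k\in H$ be homogeneous classes such that $[x_1,\dots,x_k]_W$ is non empty. Then, for any homotopy retract of $L$, with transferred brackets $\{\ell_j\}$ on $H$, and for any $x\in[x_1,\dots,x_k]_W$, $$\epsilon\,\ell_k(x_1,\dots,x_k)=x+\Gamma,\qquad \Gamma\in\sum_{j=1}^{k-1}\operatorname{Im}\ell_j,$$ where $\epsilon=(-1)^{\sum_{i=1}^{k-1}(k-i)|x_i|}$. In particular, if $\ell_j=0$ for all $j\le k-1$, then, up to a sign, $\ell_k(x_1,\dots,x_k)\in[x_1,\dots,x_k]_W$.
   Context: All vector spaces are $\mathbb{Z}$-graded over $\mathbb{Q}$; $|x|$ denotes degree. A DGL $(L,\partial)$ is a graded Lie algebra with a derivation $\partial$ of degree $-1$, $\partial^2=0$ (no boundedness is assumed). $\mathbb{L}(V)$ is the free graded Lie algebra on $V$. **Whitehead brackets.** Let $x_1,\dots,x_k\in H(L)$ be homogeneous, $n_j=|x_j|+1$. Let $U$ be the graded vector space with basis $u_{i_1\dots i_s}$, $1\le i_1<\dots<i_s\le k$, $1\le s<k$, $|u_{i_1\dots i_s}|=n_{i_1}+\dots+n_{i_s}-1$. $(\mathbb{L}(U),\partial)$ is the DGL with $\partial u_i=0$ and $$\partial u_{i_1\dots i_s}=\sum_{p=1}^{s-1}\sum_{\sigma\in\widetilde S(p,s-p)}\varepsilon(\sigma)\,[u_{i_{\sigma(1)}\dots i_{\sigma(p)}},u_{i_{\sigma(p+1)}\dots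 i_{\sigma(s)}}],$$ where $\widetilde S(p,s-p)$ is the set of $(p,s-p)$-shuffles with $\sigma(1)=1$, and $\varepsilon(\sigma)=(-1)^{|u_{i_{\sigma(1)}\dots i_{\sigma(p)}}|}\kappa$, with $\kappa$ the Koszul sign of permuting symbols of degrees $n_{i_1},\dots,n_{i_s}$ by $\sigma$. Let $\omega\in\mathbb{L}(U)$ be the cycle given by the right-hand side for $s=k$, $i_j=j$. The $k$th order Whitehead bracket set $[x_1,\dots,x_k]_W\subset H(L)$ is the (possibly empty) set of homology classes $\overline{\phi(\omega)}$, where $\phi\colon(\mathbb{L}(U),\partial)\to L$ runs over DGL morphisms such that $\phi(u_j)$ is a cycle representing $x_j$ for $j=1,\dots,k$. **Homotopy retracts.** A homotopy retract $(L,i,q,K)$ of $L$ consists of chain maps $i\colon(H,0)\to(L,\partial)$, a quasi-isomorphism inducing the identity on $H=H(L)$, and $q\colon(L,\partial)\to(H,0)$ with $qi=\mathrm{id}_H$, and a degree $1$ linear map $K\colon L\to L$ with $\mathrm{id}_L-iq=\partial K+K\partial$. **Transferred brackets.** A homotopy retract induces a minimal $L_\infty$ structure $\{\ell_j\}_{j\ge1}$ on $H$ ($\ell_1=0$) given for $k\ge2$ by $\ell_k=\sum_{T\in\mathscr{T}_k}\frac{1}{|\mathrm{Aut}(T)|}\,q\circ\widetilde\ell_T\circ\mathcal{S}_k$. Here $\mathscr{T}_k$ is the set of isomorphism classes of binary rooted trees with $k$ leaves, each drawn in the plane (trees differing by exchanging the two branches at a vertex are isomorphic), and $\mathrm{Aut}(T)$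 is the automorphism group of the rooted tree. $\mathcal{S}_k(v_1\otimes\dots\otimes v_k)=\sum_{\sigma\in S_k}\varepsilon_\sigma\varepsilon\,v_{\sigma(1)}\otimes\dots\otimes v_{\sigma(k)}$, with $\varepsilon_\sigma$ the signature and $\varepsilon$ the Koszul sign. $\widetilde\ell_T\colon H^{\otimes k}\to L$ is obtained by composing down from the leaves to the root, labelling leaves by $i$, internal edges by $K$, and each internal vertex by $(-1)^{p-1}[\,,]$, with $p$ the number of leaves above its left input; tensor products of maps are evaluated by $(f\otimes g)(a\otimes b)=(-1)^{|g||a|}f(a)\otimes g(b)$. $\operatorname{Im}\ell_j\subset H$ is the image of the linear map $\ell_j\colon H^{\otimes j}\to H$. *)

(* Defs.v *)
From HB Require Import structures.
From mathcomp Require Import all_boot all_order perm all_algebra.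
From mathcomp Require Import zify.
From mathcomp Require Import finmap boolp.
From mathcomp.multinomials Require Import monalg.

Set Implicit Arguments.
Unset Strict Implicit.
Unset Printing Implicit Defensive.

Import GRing.Theory.
Local Open Scope ring_scope.
Local Open Scope quotient_scope.

Definition signz (n : int) : rat := (-1) ^ n.

Lemma signzM m n : signz (m + n) = signz m * signz n.
Proof. by rewrite /signz expfzDr. Qed.

Lemma signzK m : signz m * signz m = 1.
Proof. by rewrite /signz -expfzMl mulrNN mulr1 exp1rz. Qed.

(* A grading V = (+)_n V_n is given by the projections gpart n of V onto V_n;
   the homogeneous elements of degree n are those with gpart n x = x.  Elements
   are finite sums of homogeneous ones, and no boundedness is imposed. *)
HB.mixin Record Lmodule_isGraded V of GRing.Lmodule rat V := {
  gpart : int -> V -> V;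
  gpart_is_linear : forall n, linear (gpart n);
  gpart_gpart : forall m n x,
    gpart m (gpart n x) = if m == n then gpart n x else 0;
  gpart_sum : forall x, exists2 s : seq int, uniq s & x = \sum_(n <- s) gpart n x
}.

#[short(type="gradedModType")]
HB.structure Definition GradedModule :=
  {V of Lmodule_isGraded V & GRing.Lmodule rat V}.

Definition homog (V : gradedModType) (n : int) : pred V := [pred x | gpart n x == x].

HB.mixin Record GradedModule_isLie L of GradedModule L := {
  lbr : L -> L -> L;
  lbr_linearl : forall y, linear (lbr^~ y);
  lbr_linearr : forall x, linear (lbr x);
  lbr_homog : forall m n x y,
    homog m x -> homog n y -> homog (m + n) (lbr x y);
  lbr_anti : forall m n x y, homog m x -> homog n y ->
    lbr x y = - (signz (m * n) *: lbr y x);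
  lbr_jacobi : forall m n x y z, homog m x -> homog n y ->
    lbr x (lbr y z) = lbr (lbr x y) z + signz (m * n) *: lbr y (lbr x z)
}.

#[short(type="gradedLieType")]
HB.structure Definition GradedLie :=
  {L of GradedModule_isLie L & GradedModule L}.

HB.mixin Record GradedLie_isDG L of GradedLie L := {
  ldiff : L -> L;
  ldiff_is_linear : linear ldiff;
  ldiff_homog : forall n x, homog n x -> homog (n - 1) (ldiff x);
  ldiff_lbr : forall n x y, homog n x ->
    ldiff (lbr x y) = lbr (ldiff x) y + signz n *: lbr x (ldiff y);
  ldiff_ldiff : forall x, ldiff (ldiff x) = 0
}.

#[short(type="dgLieType")]
HB.structure Definition DGLie := {L of GradedLie_isDG L & GradedLie L}.

HB.instance Definition _ (V : gradedModType) (n : int) :=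
  GRing.isLinear.Build rat V V *:%R (gpart n) (gpart_is_linear n).
HB.instance Definition _ (L : dgLieType) :=
  GRing.isLinear.Build rat L L *:%R (@ldiff L) (@ldiff_is_linear L).

Section GradedTheory.
Variable V : gradedModType.
Implicit Types x y : V.

Lemma homogP n x : reflect (gpart n x = x) (homog n x).
Proof. exact: eqP. Qed.

Lemma homog_gpart n x : homog n (gpart n x).
Proof. by apply/homogP; rewrite gpart_gpart eqxx. Qed.

Lemma homog_gpartN m n x : homog n x -> m != n -> gpart m x = 0.
Proof. by move=> /homogP <- /negPf mn; rewrite gpart_gpart mn. Qed.

Lemma homog_lin n k x y : homog n x -> homog n y -> homog n (k *: x + y).
Proof. by move=> /homogP xn /homogP yn; apply/homogP; rewrite linearP /= xn yn. Qed.

Lemma homog0 n : homog n (0 : V).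
Proof. by apply/homogP; rewrite linear0. Qed.

Lemma homogZ n k x : homog n x -> homog n (k *: x).
Proof. by move=> xn; rewrite -[_ *: _]addr0; apply: homog_lin (homog0 n). Qed.

Lemma homogD n x y : homog n x -> homog n y -> homog n (x + y).
Proof. by move=> xn yn; rewrite -[x]scale1r; apply: homog_lin. Qed.

Lemma homogB n x y : homog n x -> homog n y -> homog n (x - y).
Proof. by move=> xn yn; rewrite addrC -scaleN1r; apply: homog_lin. Qed.

Lemma homog_sum n (I : Type) (r : seq I) (P : pred I) (F : I -> V) :
  (forall i, P i -> homog n (F i)) -> homog n (\sum_(i <- r | P i) F i).
Proof.
move=> hF; elim/big_ind: _ => // [|x y]; [exact: homog0|exact: homogD].
Qed.

Lemma gpart_big (f : int -> V) s n : uniq s -> (forall i, homog i (f i)) ->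
  gpart n (\sum_(i <- s) f i) = if n \in s then f n else 0.
Proof.
move=> us hf; rewrite linear_sum /=; case: ifP => [ns|/negP ns].
  rewrite (bigD1_seq n) //= big1 ?addr0 => [|i /negPf ni].
    exact/homogP.
  by rewrite (homog_gpartN (hf i)) // eq_sym ni.
rewrite big_seq big1 // => i si; rewrite (homog_gpartN (hf i)) //.
by apply/eqP => ni; case: ns; rewrite ni.
Qed.

End GradedTheory.

Section Homology.
Variable L : dgLieType.

Definition cycle_pred : {pred L} := [pred z | ldiff z == 0].

Lemma cycle_pred_closed : submod_closed cycle_pred.
Proof.
split=> [|a u v]; rewrite !inE ?linear0 //.
by move=> /eqP u0 /eqP v0; rewrite linearP /= u0 v0 scaler0 addr0.
Qed.
HB.instance Definition _ :=
  GRing.isSubmodClosed.Build rat L cycle_pred cycle_pred_closed.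

(* H(L) = ker d / im d, graded by the classes of homogeneous cycles. *)
Record cycle : predArgType := Cycle { cval : L; _ : cval \in cycle_pred }.
HB.instance Definition _ := [isSub for cval].
HB.instance Definition _ := [Choice of cycle by <:].
HB.instance Definition _ := [SubChoice_isSubLmodule of cycle by <:].

Definition boundary : {pred cycle} := fun z => `[< exists y : L, cval z = ldiff y >].

Lemma boundaryP z : reflect (exists y, cval z = ldiff y) (z \in boundary).
Proof. exact: asboolP. Qed.

Lemma boundary_closed : submod_closed boundary.
Proof.
split=> [|a u v]; first by apply/boundaryP; exists 0; rewrite linear0.
move=> /boundaryP[y uy] /boundaryP[y' vy']; apply/boundaryP.
by exists (a *: y + y'); rewrite linearP /= -uy -vy'.
Qed.
HB.instance Definition _ :=
  GRing.isSubmodClosed.Build rat cycle boundary boundary_closed.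

Definition homology := Quotient.quot boundary.
HB.instance Definition _ := GRing.Zmodule.on homology.

Definition hclass (z : cycle) : homology := \pi_(Quotient.quot boundary) z.

Lemma hclass_surj h : exists z, hclass z = h.
Proof. by exists (repr h); rewrite /hclass reprK. Qed.

Lemma hclass_eq z z' : (hclass z == hclass z') = (z - z' \in boundary).
Proof. by rewrite Quotient.idealrBE. Qed.

Lemma hclass_is_additive : {morph hclass : x y / x + y}.
Proof. by move=> x y; rewrite /hclass piE. Qed.

Lemma hclass0 : hclass 0 = 0.
Proof. by rewrite /hclass piE. Qed.

Definition hscale (a : rat) (h : homology) : homology := hclass (a *: repr h).

Lemma hscale_class a z : hscale a (hclass z) = hclass (a *: z).
Proof.
apply/eqP; rewrite hclass_eq -scalerBr rpredZ// -hclass_eq.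
by rewrite /hclass reprK.
Qed.

Fact hscaleA a b h : hscale a (hscale b h) = hscale (a * b) h.
Proof. by have [z <-] := hclass_surj h; rewrite !hscale_class scalerA. Qed.
Fact hscale1 : left_id 1 hscale.
Proof. by move=> h; have [z <-] := hclass_surj h; rewrite hscale_class scale1r. Qed.
Fact hscaleDr : right_distributive hscale +%R.
Proof.
move=> a h h'; have [z <-] := hclass_surj h; have [z' <-] := hclass_surj h'.
by rewrite -hclass_is_additive !hscale_class scalerDr hclass_is_additive.
Qed.
Fact hscaleDl h : {morph hscale^~ h : a b / a + b}.
Proof.
move=> a b; have [z <-] := hclass_surj h.
by rewrite !hscale_class scalerDl hclass_is_additive.
Qed.
HB.instance Definition _ := GRing.Zmodule_isLmodule.Build rat homology
  hscaleA hscale1 hscaleDr hscaleDl.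

Lemma hclass_is_linear : linear hclass.
Proof. by move=> a u v; rewrite hclass_is_additive -hscale_class. Qed.
HB.instance Definition _ :=
  GRing.isLinear.Build rat cycle homology *:%R hclass hclass_is_linear.

Lemma ldiff_gpart n (x : L) : ldiff (gpart n x) = gpart (n - 1) (ldiff x).
Proof.
have [s us xE] := gpart_sum x.
have -> : gpart n x = if n \in s then gpart n x else 0.
  by rewrite {1}xE (gpart_big _ us) // => i; apply: homog_gpart.
pose f (i : int) := i - 1; have injf : injective f by apply: addIr.
have -> : ldiff x = \sum_(i <- map f s) ldiff (gpart (i + 1) x).
  rewrite {1}xE linear_sum big_map; apply: eq_bigr => i _ /=.
  by rewrite /f addrNK.
rewrite gpart_big ?map_inj_uniq //.
  by rewrite (mem_map injf s n) addrNK; case: ifP => // _; rewrite linear0.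
by move=> i; rewrite -{1}[i](addrK 1); apply/ldiff_homog/homog_gpart.
Qed.

Lemma cycle_gpart_subproof n (z : cycle) : gpart n (cval z) \in cycle_pred.
Proof.
case: z => z /= /eqP z0; apply/eqP.
by rewrite ldiff_gpart z0 linear0.
Qed.
Definition cycle_gpart n z := Cycle (cycle_gpart_subproof n z).

Definition hpart n (h : homology) : homology := hclass (cycle_gpart n (repr h)).

Lemma hpart_class n z : hpart n (hclass z) = hclass (cycle_gpart n z).
Proof.
apply/eqP; rewrite hclass_eq; apply/boundaryP.
have : repr (hclass z) - z \in boundary by rewrite -hclass_eq /hclass reprK.
move=> /boundaryP[y yE]; exists (gpart (n + 1) y).
rewrite ldiff_gpart addrK -yE !linearB /=; congr (_ - _).
Qed.

Fact hpart_is_linear n : linear (hpart n).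
Proof.
move=> a h h'; have [z <-] := hclass_surj h; have [z' <-] := hclass_surj h'.
rewrite -linearP !hpart_class -linearP; congr hclass; apply: val_inj => /=.
by rewrite linearP.
Qed.

Fact hpart_hpart m n h : hpart m (hpart n h) = if m == n then hpart n h else 0.
Proof.
have [z <-] := hclass_surj h; rewrite !hpart_class.
case: eqP => [->|/eqP/negPf mn].
  by congr hclass; apply: val_inj; rewrite /= gpart_gpart eqxx.
by rewrite -hclass0; congr hclass; apply: val_inj; rewrite /= gpart_gpart mn.
Qed.

Fact hpart_sum h : exists2 s : seq int, uniq s & h = \sum_(n <- s) hpart n h.
Proof.
have [z <-] := hclass_surj h; have [s us zE] := gpart_sum (cval z).
exists s => //; rewrite (eq_bigr _ (fun n _ => hpart_class n z)) -linear_sum.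
by congr hclass; apply: val_inj; rewrite raddf_sum.
Qed.

HB.instance Definition _ := Lmodule_isGraded.Build homology
  hpart_is_linear hpart_hpart hpart_sum.

End Homology.

Section AlgebraIdentities.
Variable A : algType rat.
Implicit Types (a b d : A) (r : rat).

Lemma commutator_jacobi r1 r2 r3 a b d : r1 * r1 = 1 ->
  a * (b * d - r3 *: (d * b)) - (r1 * r2) *: ((b * d - r3 *: (d * b)) * a) =
  (a * b - r1 *: (b * a)) * d - (r2 * r3) *: (d * (a * b - r1 *: (b * a))) +
  r1 *: (b * (a * d - r2 *: (d * a)) -
         (r1 * r3) *: ((a * d - r2 *: (d * a)) * b)).
Proof.
move=> r1K.
rewrite !(mulrBl, mulrBr) -!scalerAl -!scalerAr !scalerBr !scalerA !mulrA r1K.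
rewrite mul1r [r2 * r3 * r1]mulrC mulrA [r3 * r2]mulrC !opprB.
move: (a * b * d) (r3 *: (a * d * b)) ((r1 * r2) *: (b * d * a)) => x1 x2 x3.
move: ((r1 * r2 * r3) *: (d * b * a)) (r1 *: (b * a * d)) => x4 x5.
move: ((r2 * r3) *: (d * a * b)) => x6.
by rewrite [RHS]addrACA !subrKA [LHS]addrACA [RHS]addrACA [- x2 + _]addrC.
Qed.

Lemma derivation_cat r1 r2 (u w t u' w' t' : A) :
  u' * (w * t) + r1 *: (u * (w' * t + r2 *: (w * t'))) =
  (u' * w + r1 *: (u * w')) * t + (r1 * r2) *: (u * w * t').
Proof.
rewrite mulrDr mulrDl scalerDr -scalerAr -scalerAl scalerA !mulrA.
exact: addrA.
Qed.

Lemma derivation_lin r1 r2 (x y x' y' : A) :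
  r1 *: x + y + r2 *: (r1 *: x' + y') =
  r1 *: (x + r2 *: x') + (y + r2 *: y').
Proof. by rewrite !scalerDr addrACA !scalerA [r1 * r2]mulrC. Qed.

Lemma commutator_der rm rn rmn (a b a' b' : A) : rm * rm = 1 ->
  a' * b + rm *: (a * b') - rmn *: (b' * a + rn *: (b * a')) =
  a' * b - (rmn * rn) *: (b * a') +
  rm *: (a * b' - (rmn * rm) *: (b' * a)).
Proof.
move=> rmK; rewrite scalerDr scalerBr !scalerA mulrCA rmK mulr1.
by rewrite opprD [RHS]addrACA; congr (_ + _); apply: addrC.
Qed.

End AlgebraIdentities.

(* The free graded Lie algebra L(V) on the graded space V with basis U, the
   generator u having degree deg u: it is the graded Lie subalgebra generated by
   V in the tensor algebra T(V), with the graded commutator as bracket.  T(V) is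
   the algebra of the free monoid of words on U. *)
Section FreeLie.
Variables (U : choiceType) (deg : U -> int).

Definition tensalg : Type := {malg rat[{fmonom U}]}.
HB.instance Definition _ := GRing.NzRing.on tensalg.
HB.instance Definition _ := GRing.Lalgebra.on tensalg.

Implicit Types (a b c : tensalg) (s t : seq U) (w v : {fmonom U}).

Definition word s : tensalg := << FMonom s >>.
Definition wdeg s : int := \sum_(u <- s) deg u.

Definition tlin (V : lmodType rat) (f : seq U -> V) a : V :=
  \sum_(w <- msupp (a : {malg rat[{fmonom U}]})) (a : {malg rat[{fmonom U}]})@_w *: f w.

Lemma tlin_def (V : lmodType rat) (f : seq U -> V) a :
  tlin f a = \sum_(w <- msupp (a : {malg rat[{fmonom U}]}))
    (a : {malg rat[{fmonom U}]})@_w *: f w.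
Proof. by []. Qed.

Lemma tlinE (V : lmodType rat) (f : seq U -> V) (A : {fset {fmonom U}}) a :
  (msupp (a : {malg rat[{fmonom U}]}) `<=` A)%fset ->
  tlin f a = \sum_(w <- A) (a : {malg rat[{fmonom U}]})@_w *: f w.
Proof.
move=> sA; rewrite /tlin (big_fset_incl _ sA) // => w _ /mcoeff_outdom ->.
by rewrite scale0r.
Qed.

Lemma tlin_is_linear (V : lmodType rat) (f : seq U -> V) : linear (tlin f).
Proof.
move=> k a b; set A := (msupp (a : {malg rat[{fmonom U}]}) `|` msupp (b : {malg rat[{fmonom U}]}))%fset.
rewrite (@tlinE _ f A a) ?fsubsetUl // (@tlinE _ f A b) ?fsubsetUr //.
rewrite (@tlinE _ f A); last first.
  apply: fsubset_trans (msuppD_le _ _) _.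
  by apply: fsetSU; apply: msuppZ_le.
rewrite scaler_sumr -big_split /=; apply: eq_bigr => w _.
by rewrite mcoeffD mcoeffZ scalerDl scalerA.
Qed.
HB.instance Definition _ (V : lmodType rat) (f : seq U -> V) :=
  GRing.isLinear.Build rat tensalg V *:%R (@tlin V f) (tlin_is_linear f).

Lemma eq_tlin (V : lmodType rat) (f g : seq U -> V) a :
  f =1 g -> tlin f a = tlin g a.
Proof. by move=> fg; apply: eq_bigr => w _; rewrite fg. Qed.

Lemma tlin_fun (V : lmodType rat) k (f g : seq U -> V) a :
  tlin (fun s => k *: f s + g s) a = k *: tlin f a + tlin g a.
Proof.
rewrite /tlin scaler_sumr -big_split /=; apply: eq_bigr => w _.
by rewrite scalerDr !scalerA mulrC.
Qed.

Lemma tlin_word (V : lmodType rat) (f : seq U -> V) s : tlin f (word s) = f s.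
Proof.
by rewrite /tlin /word msuppU1 big_seq_fset1 mcoeffU1 eqxx scale1r.
Qed.

Local Opaque tlin.

Lemma tens_sum a : a = tlin word a.
Proof.
rewrite [LHS](monalgE (a : {malg rat[{fmonom U}]})) tlin_def; apply: eq_bigr => w _.
rewrite /word; case: w => w /=; apply/malgP => k.
by rewrite mcoeffZ !mcoeffU mulr_natr.
Qed.

Lemma tens_lin_ext (V : lmodType rat) (f g : {linear tensalg -> V}) :
  (forall s, f (word s) = g (word s)) -> f =1 g.
Proof.
move=> fg a; rewrite (tens_sum a) tlin_def !linear_sum; apply: eq_bigr => w _.
by rewrite !linearZ_LR fg.
Qed.

Lemma wordM s t : word s * word t = word (s ++ t).
Proof.
rewrite /word [LHS]fgmulUU mulr1.
by congr << _ >>; rewrite /mmul /= /fmmul fmE.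
Qed.

Lemma word_nil : word [::] = 1.
Proof. by rewrite /word /GRing.one /= /fgone /mone /= /fmone fmE. Qed.

Lemma tens_scaleAr k a b : k *: (a * b) = a * (k *: b).
Proof.
have sU (r : rat) (w : {fmonom U}) :
    k *: (<< r *g w >> : {malg rat[{fmonom U}]}) = << k * r *g w >>.
  by apply/malgP => x; rewrite mcoeffZ !mcoeffU mulrnAr.
rewrite [LHS](congr1 (fun z => k *: z)
  (malgME (a : {malg rat[{fmonom U}]}) (b : {malg rat[{fmonom U}]}))).
rewrite [RHS](malgMEw (fsubset_refl _) (msuppZ_le k b)) scaler_sumr.
apply: eq_bigr => v _; rewrite scaler_sumr; apply: eq_bigr => w _.
by rewrite [LHS]sU mcoeffZ mulrCA.
Qed.

HB.instance Definition _ :=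
  GRing.Lalgebra_isAlgebra.Build rat tensalg tens_scaleAr.

Lemma tens_linl k a b c : (k *: a + b) * c = k *: (a * c) + b * c.
Proof. by rewrite [LHS]mulrDl; congr (_ + _); apply/esym/scalerAl. Qed.

Lemma tens_linr k a b c : c * (k *: a + b) = k *: (c * a) + c * b.
Proof. by rewrite [LHS]mulrDr; congr (_ + _); apply/esym/scalerAr. Qed.

Local Opaque fgmul fgadd fgscale fgopp.

Definition tlmul c a : tensalg := c * a.
HB.instance Definition _ c :=
  GRing.isLinear.Build rat tensalg tensalg *:%R (tlmul c)
    (fun k a b => tens_linr k a b c).

Definition tpart n : tensalg -> tensalg :=
  tlin (fun s => if wdeg s == n then word s else 0).

Fact tpart_is_linear n : linear (tpart n).
Proof. exact: linearP. Qed.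
HB.instance Definition _ n :=
  GRing.isLinear.Build rat tensalg tensalg *:%R (tpart n) (tpart_is_linear n).

Lemma tpart_word n s : tpart n (word s) = if wdeg s == n then word s else 0.
Proof. exact: tlin_word. Qed.

Fact tpart_tpart m n a : tpart m (tpart n a) = if m == n then tpart n a else 0.
Proof.
suff H : (tpart m \o tpart n) =1
    (if m == n then tpart n : {linear tensalg -> tensalg} else \0%R).
  by rewrite [LHS]H; case: eqP.
apply: tens_lin_ext => s /=; rewrite tpart_word.
case: (eqVneq (wdeg s) n) => [<-|sn].
  rewrite tpart_word [wdeg s == m]eq_sym; case: eqP => _ //=.
  by rewrite tpart_word eqxx.
by rewrite linear0; case: eqP => _ //=; rewrite tpart_word (negPf sn).
Qed.

Fact tpart_sum a : exists2 s : seq int, uniq s & a = \sum_(n <- s) tpart n a.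
Proof.
exists (undup [seq wdeg (val w) | w <- msupp (a : {malg rat[{fmonom U}]})]).
  exact: undup_uniq.
rewrite [in LHS](tens_sum a) /tpart !tlin_def exchange_big /= big_seq [RHS]big_seq.
apply: eq_bigr => w wa; rewrite (bigD1_seq (wdeg w)) ?undup_uniq //=; last first.
  by rewrite mem_undup; apply/mapP; exists w.
rewrite eqxx big1 ?addr0 // => i /negPf wi.
by rewrite eq_sym wi scaler0.
Qed.

HB.instance Definition _ := Lmodule_isGraded.Build tensalg
  tpart_is_linear tpart_tpart tpart_sum.

Lemma homog_ind n (P : tensalg -> Prop) :
  P 0 -> (forall k a b, P a -> P b -> P (k *: a + b)) ->
  (forall s, wdeg s = n -> P (word s)) -> forall a, homog n a -> P a.
Proof.
move=> P0 PD Pw a /homogP <-; rewrite /gpart /= /tpart tlin_def.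
elim/big_ind: _ => // [x y Px Py|w _]; first by rewrite -[x]scale1r; apply: PD.
by rewrite -[_ *: _]addr0; apply: PD => //; case: eqP => // /Pw.
Qed.

Lemma homog_word s : homog (wdeg s) (word s).
Proof. by apply/homogP; rewrite [LHS]tpart_word eqxx. Qed.

Lemma homog_ext (V : lmodType rat) (f g : {linear tensalg -> V}) :
  (forall n a, homog n a -> f a = g a) -> f =1 g.
Proof. by move=> fg; apply: tens_lin_ext => s; apply/fg/homog_word. Qed.

Lemma wdeg_cons u s : wdeg (u :: s) = deg u + wdeg s.
Proof. exact: big_cons. Qed.

Lemma wdeg_cat s t : wdeg (s ++ t) = wdeg s + wdeg t.
Proof. exact: big_cat. Qed.

Lemma homogM m n a b : homog m a -> homog n b -> homog (m + n) (a * b).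
Proof.
move=> am bn; elim/homog_ind: am => [|k x y xb yb|s sm].
- by rewrite mul0r homog0.
- by rewrite tens_linl homog_lin.
elim/homog_ind: bn => [|k x y xb yb|t tn].
- by rewrite mulr0 homog0.
- by rewrite tens_linr homog_lin.
by rewrite wordM -sm -tn -wdeg_cat homog_word.
Qed.

Definition tbr a b : tensalg :=
  tlin (fun s => tlin (fun t =>
    word s * word t - signz (wdeg s * wdeg t) *: (word t * word s)) b) a.

Fact tbr_linearl b : linear (tbr^~ b).
Proof. by move=> k x y; apply: linearP. Qed.

Fact tbr_linearr a : linear (tbr a).
Proof.
move=> k x y; rewrite -[RHS]tlin_fun; apply: eq_tlin => s; exact: tlin_is_linear.
Qed.
HB.instance Definition _ a :=
  GRing.isLinear.Build rat tensalg tensalg *:%R (tbr a) (tbr_linearr a).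

Lemma tbr_sum a (r : seq int) (f : int -> tensalg) :
  tbr a (\sum_(i <- r) f i) = \sum_(i <- r) tbr a (f i).
Proof. exact: linear_sum. Qed.

Lemma lin_comb (V : lmodType rat) (k r : rat) (x y x' y' : V) :
  k *: (x - r *: y) + (x' - r *: y') = (k *: x + x') - r *: (k *: y + y').
Proof. by rewrite scalerBr scalerDr opprD addrACA !scalerA [k * r]mulrC. Qed.

Lemma tbrE m n a b : homog m a -> homog n b ->
  tbr a b = a * b - signz (m * n) *: (b * a).
Proof.
move=> am bn; elim/homog_ind: am => [|k x y xb yb|s sm].
- by rewrite mul0r mulr0 scaler0 subr0 /tbr linear0.
- rewrite tbr_linearl xb yb tens_linl tens_linr.
  exact: lin_comb.
elim/homog_ind: bn => [|k x y xb yb|t tn].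
- by rewrite mul0r mulr0 scaler0 subr0 linear0.
- rewrite tbr_linearr xb yb tens_linl tens_linr.
  exact: lin_comb.
by rewrite /tbr !tlin_word sm tn.
Qed.

Fact tbr_homog m n a b : homog m a -> homog n b -> homog (m + n) (tbr a b).
Proof.
move=> am bn; rewrite (tbrE am bn) homogB ?homogM // homogZ //.
by rewrite addrC homogM.
Qed.

Fact tbr_anti m n a b : homog m a -> homog n b ->
  tbr a b = - (signz (m * n) *: tbr b a).
Proof.
move=> am bn; rewrite (tbrE am bn) (tbrE bn am) [n * m]mulrC.
by rewrite scalerBr scalerA signzK scale1r opprB.
Qed.

Fact tbr_jacobi m n a b (d : tensalg) : homog m a -> homog n b ->
  tbr a (tbr b d) = tbr (tbr a b) d + signz (m * n) *: tbr b (tbr a d).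
Proof.
move=> am bn; move: d.
pose f : {linear tensalg -> tensalg} := tbr a \o tbr b.
pose g : {linear tensalg -> tensalg} :=
  tbr (tbr a b) \+ signz (m * n) \*: (tbr b \o tbr a).
apply: (@homog_ext _ f g) => p d dp; rewrite /f /g /=.
rewrite (tbrE am (tbr_homog bn dp)) (tbrE (tbr_homog am bn) dp).
rewrite (tbrE bn (tbr_homog am dp)).
rewrite (tbrE am bn) (tbrE bn dp) (tbrE am dp).
rewrite [n * (m + p)]mulrDr [m * (n + p)]mulrDr [(m + n) * p]mulrDl [n * m]mulrC.
by rewrite !signzM; apply: commutator_jacobi; apply: signzK.
Qed.

HB.instance Definition _ := GradedModule_isLie.Build tensalg
  tbr_linearl tbr_linearr tbr_homog tbr_anti tbr_jacobi.


Inductive lie_span : tensalg -> Prop :=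
| lie_gen u : lie_span (word [:: u])
| lie_0 : lie_span 0
| lie_lin k a b : lie_span a -> lie_span b -> lie_span (k *: a + b)
| lie_br a b : lie_span a -> lie_span b -> lie_span (lbr a b).

Definition lie_pred : {pred tensalg} := fun a => `[< lie_span a >].

Lemma lie_predP a : reflect (lie_span a) (a \in lie_pred).
Proof. exact: asboolP. Qed.

Fact lie_pred_closed : submod_closed lie_pred.
Proof.
split=> [|k a b]; first by apply/lie_predP/lie_0.
by move=> /lie_predP la /lie_predP lb; apply/lie_predP/lie_lin.
Qed.
HB.instance Definition _ :=
  GRing.isSubmodClosed.Build rat tensalg lie_pred lie_pred_closed.

Record freelie : predArgType := FreeLie { flval : tensalg; _ : flval \in lie_pred }.
HB.instance Definition _ := [isSub for flval].
HB.instance Definition _ := [Choice of freelie by <:].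
HB.instance Definition _ := [SubChoice_isSubLmodule of freelie by <:].
Implicit Types x y z : freelie.

Lemma homog_letter u : homog (deg u) (word [:: u]).
Proof. by have := homog_word [:: u]; rewrite /wdeg big_seq1. Qed.

Lemma lie_span_sum (r : seq int) (f : int -> tensalg) :
  (forall i, lie_span (f i)) -> lie_span (\sum_(i <- r) f i).
Proof.
move=> lf; elim/big_ind: _ => [|a b la lb|//]; first exact: lie_0.
by rewrite -[a]scale1r; apply: lie_lin.
Qed.

Lemma lbr_parts (V : lmodType rat) (f : {linear tensalg -> V}) a b :
  exists r s : seq int, f (lbr a b) =
    \sum_(i <- r) \sum_(j <- s) f (lbr (gpart i a) (gpart j b)).
Proof.
have [r _ aE] := gpart_sum a; have [s _ bE] := gpart_sum b; exists r, s.
rewrite {1}aE {1}bE -[LHS]/(f (tbr^~ _ _)).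
have -> (c : tensalg) : tbr (\sum_(i <- r) gpart i a) c = \sum_(i <- r) tbr (gpart i a) c.
  exact: (linear_sum (tlin _)).
by rewrite linear_sum; apply: eq_bigr => i _; rewrite tbr_sum linear_sum.
Qed.

Lemma lie_span_gpart n a : lie_span a -> lie_span (gpart n a).
Proof.
move=> la; elim: la n => {a} [u||k a b _ IHa _ IHb|a b _ IHa _ IHb] n.
- case: (eqVneq n (deg u)) => [->|nu].
    by have /homogP -> := homog_letter u; apply: lie_gen.
  by rewrite (homog_gpartN (homog_letter u)) //; apply: lie_0.
- by rewrite linear0; apply: lie_0.
- by rewrite linearP; apply: lie_lin; [apply: IHa|apply: IHb].
have [r [s ->]] := lbr_parts (gpart n) a b.
apply: lie_span_sum => i; apply: lie_span_sum => j.
rewrite -[X in lie_span X]/(gpart n (lbr _ _)).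
have ab := lbr_homog _ _ _ _ (homog_gpart i a) (homog_gpart j b).
case: (eqVneq n (i + j)) => [->|nij]; last by rewrite (homog_gpartN ab) //; apply: lie_0.
by have /homogP -> := ab; apply: lie_br; [apply: IHa|apply: IHb].
Qed.

Fact fpart_subproof n x : gpart n (flval x) \in lie_pred.
Proof. by apply/lie_predP/lie_span_gpart/lie_predP; case: x. Qed.
Definition fpart n x := FreeLie (fpart_subproof n x).

Fact fpart_is_linear n : linear (fpart n).
Proof. by move=> k x y; apply: val_inj; rewrite /= linearP. Qed.
Fact fpart_fpart m n x : fpart m (fpart n x) = if m == n then fpart n x else 0.
Proof. by apply: val_inj; rewrite /= gpart_gpart; case: eqP. Qed.
Fact fpart_sum x : exists2 s : seq int, uniq s & x = \sum_(n <- s) fpart n x.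
Proof.
have [s us xE] := gpart_sum (flval x); exists s => //; apply: val_inj.
by rewrite raddf_sum.
Qed.
HB.instance Definition _ := Lmodule_isGraded.Build freelie
  fpart_is_linear fpart_fpart fpart_sum.

Lemma homog_flval n x : homog n x = homog n (flval x).
Proof. by rewrite /homog /= -val_eqE. Qed.

Fact fbr_subproof x y : lbr (flval x) (flval y) \in lie_pred.
Proof. by apply/lie_predP/lie_br; apply/lie_predP; [case: x|case: y]. Qed.
Definition fbr x y := FreeLie (fbr_subproof x y).

Fact fbr_linearl y : linear (fbr^~ y).
Proof. by move=> k x z; apply: val_inj; apply: lbr_linearl. Qed.
Fact fbr_linearr x : linear (fbr x).
Proof. by move=> k y z; apply: val_inj; apply: lbr_linearr. Qed.
Fact fbr_homog m n x y : homog m x -> homog n y -> homog (m + n) (fbr x y).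
Proof. by rewrite !homog_flval; apply: lbr_homog. Qed.
Fact fbr_anti m n x y : homog m x -> homog n y ->
  fbr x y = - (signz (m * n) *: fbr y x).
Proof. by rewrite !homog_flval => xm yn; apply: val_inj; apply: lbr_anti. Qed.
Fact fbr_jacobi m n x y z : homog m x -> homog n y ->
  fbr x (fbr y z) = fbr (fbr x y) z + signz (m * n) *: fbr y (fbr x z).
Proof. by rewrite !homog_flval => xm yn; apply: val_inj; apply: lbr_jacobi. Qed.
HB.instance Definition _ := GradedModule_isLie.Build freelie
  fbr_linearl fbr_linearr fbr_homog fbr_anti fbr_jacobi.

Definition fgen u : freelie := FreeLie (introT (lie_predP _) (lie_gen u)).

Lemma homog_fgen u : homog (deg u) (fgen u).
Proof. by rewrite homog_flval homog_letter. Qed.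

(* The derivation fder of degree -1 of L(V) extending u |-> du u. *)
Section Derivation.
Variable du : U -> freelie.

Fixpoint wder s : tensalg :=
  if s is u :: s' then
    flval (du u) * word s' + signz (deg u) *: (word [:: u] * wder s')
  else 0.
Definition tder : tensalg -> tensalg := tlin wder.

Fact tder_is_linear : linear tder.
Proof. exact: tlin_is_linear. Qed.
HB.instance Definition _ :=
  GRing.isLinear.Build rat tensalg tensalg *:%R tder tder_is_linear.

Lemma wder_cat s t :
  wder (s ++ t) = wder s * word t + signz (wdeg s) *: (word s * wder t).
Proof.
elim: s => [|u s IHs] /=.
  by rewrite word_nil mul0r mul1r add0r /wdeg big_nil scale1r.
rewrite IHs -!wordM -[word (u :: s)](wordM [:: u]) wdeg_cons signzM.
exact: derivation_cat.
Qed.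

Lemma tder_mul n a b : homog n a ->
  tder (a * b) = tder a * b + signz n *: (a * tder b).
Proof.
move=> an; elim/homog_ind: an => [|k a1 a2 IH1 IH2|s sn].
- by rewrite !mul0r linear0 mul0r add0r scaler0.
- rewrite (tens_linl k a1 a2 b) (tens_linl k a1 a2 (tder b)).
  rewrite (tder_is_linear k (a1 * b) (a2 * b)).
  rewrite (tder_is_linear k a1 a2).
  rewrite [X in k *: X + _ = _]IH1 [X in _ + X = _]IH2.
  by rewrite (tens_linl k (tder a1)); symmetry; apply: derivation_lin.
rewrite -sn; move: b.
pose f : {linear tensalg -> tensalg} := tder \o tlmul (word s).
pose g : {linear tensalg -> tensalg} :=
  tlmul (tder (word s)) \+ signz (wdeg s) \*: (tlmul (word s) \o tder).
apply: (tens_lin_ext (f := f) (g := g)) => t; rewrite /f /g /= /tlmul wordM.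
by rewrite /tder !tlin_word wder_cat.
Qed.

Hypothesis du_homog : forall u, homog (deg u - 1) (du u).

Lemma tder_homog n a : homog n a -> homog (n - 1) (tder a).
Proof.
move=> an; elim/homog_ind: an => [|k b c hb hc|s <-].
- by rewrite linear0 homog0.
- by rewrite tder_is_linear homog_lin.
rewrite /tder tlin_word; elim: s => [|u s IHs] /=; first exact: homog0.
rewrite wdeg_cons; apply: homogD; last by apply: homogZ; rewrite -addrA homogM ?homog_letter.
by rewrite addrAC homogM ?homog_word // -homog_flval.
Qed.

Lemma tder_lbr n a b : homog n a ->
  tder (lbr a b) = lbr (tder a) b + signz n *: lbr a (tder b).
Proof.
move=> an; move: b.
pose f : {linear tensalg -> tensalg} := tder \o tbr a.
pose g : {linear tensalg -> tensalg} :=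
  tbr (tder a) \+ signz n \*: (tbr a \o tder).
apply: (@homog_ext _ f g) => p b bp; rewrite /f /g /=.
rewrite (tbrE an bp) (tbrE (tder_homog an) bp) (tbrE an (tder_homog bp)).
rewrite linearB linearZ [X in X - _ = _](tder_mul b an).
rewrite [X in _ - X = _](congr1 ( *:%R (signz (n * p))) (tder_mul a bp)).
rewrite [(n - 1) * p]mulrBl [n * (p - 1)]mulrBr mul1r mulr1.
have sgN q r : signz (q - r) = signz q * signz r.
  rewrite signzM; congr (_ * _); rewrite -[LHS]mulr1 -(signzK r) mulrA -signzM.
  by rewrite addNr /signz expr0z mul1r.
by rewrite !sgN; apply: commutator_der; apply: signzK.
Qed.

Lemma lie_span_tder a : lie_span a -> lie_span (tder a).
Proof.
move=> la; suff H n : lie_span (tder (gpart n a)).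
  have [s _ ->] := gpart_sum a; rewrite linear_sum; exact: lie_span_sum.
elim: la n => {a} [u||k a b _ IHa _ IHb|a b la IHa lb IHb] n.
- case: (eqVneq n (deg u)) => [->|nu]; last first.
    by rewrite (homog_gpartN (homog_letter u)) // linear0; apply: lie_0.
  have /homogP -> := homog_letter u.
  rewrite /tder tlin_word /= mulr0 scaler0 addr0 word_nil mulr1.
  by apply/lie_predP; case: (du u).
- by rewrite !linear0; apply: lie_0.
- by rewrite !linearP; apply: lie_lin; [apply: IHa|apply: IHb].
have [r [s E]] := lbr_parts (tder \o gpart n) a b; rewrite [tder _]E {E}.
apply: lie_span_sum => i; apply: lie_span_sum => j.
rewrite -[X in lie_span X]/(tder (gpart n (lbr _ _))).
have ia := homog_gpart i a; have ab := lbr_homog _ _ _ _ ia (homog_gpart j b).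
case: (eqVneq n (i + j)) => [->|nij]; last first.
  by rewrite (homog_gpartN ab) // linear0; apply: lie_0.
have la' := lie_span_gpart i la; have lb' := lie_span_gpart j lb.
have /homogP -> := ab; rewrite (tder_lbr _ ia) addrC.
by apply: lie_lin; [apply: (lie_br la' (IHb j))|apply: (lie_br (IHa i) lb')].
Qed.

Fact fder_subproof x : tder (flval x) \in lie_pred.
Proof. by apply/lie_predP/lie_span_tder/lie_predP; case: x. Qed.
Definition fder x := FreeLie (fder_subproof x).

Lemma fder_is_linear : linear fder.
Proof. by move=> k x y; apply: val_inj; apply: tder_is_linear. Qed.

Lemma fder_homog n x : homog n x -> homog (n - 1) (fder x).
Proof. by rewrite !homog_flval; apply: tder_homog. Qed.

Lemma fder_lbr n x y : homog n x ->
  fder (lbr x y) = lbr (fder x) y + signz n *: lbr x (fder y).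
Proof. by rewrite homog_flval => xn; apply: val_inj; apply: tder_lbr. Qed.

Lemma fder_fgen u : fder (fgen u) = du u.
Proof.
apply: val_inj; rewrite /= /tder tlin_word /=.
by rewrite mulr0 scaler0 addr0 word_nil mulr1.
Qed.

End Derivation.
End FreeLie.

Section Signs.
Variable s : nat.
Implicit Types (e : 'I_s -> int) (sigma : 'S_s) (p : nat).

(* Koszul sign of v_0 ... v_(s-1) -> v_(sigma 0) ... v_(sigma (s-1)), for symbols
   v_a of degree e a. *)
Definition koszul e sigma : rat :=
  \prod_(a < s) \prod_(b < s | (a < b)%N && (sigma b < sigma a)%N)
    signz (e (sigma a) * e (sigma b)).

(* (p, s - p)-shuffles: sigma increases on the first p positions and on the
   last s - p ones. *)
Definition shuffle p sigma : bool :=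
  [forall a : 'I_s, forall b : 'I_s,
     (a < b)%N && ((b < p)%N || (p <= a)%N) ==> (sigma a < sigma b)%N].

Definition fixes_first sigma : bool :=
  [forall a : 'I_s, (a == 0%N :> nat) ==> (sigma a == 0%N :> nat)].

End Signs.

(* Indices run over 0, ..., k - 1.  A sequence i_1 < ... < i_s is represented by
   the set I of its members, so that i_a = enum_val a for a : 'I_#|I|; the
   generators u_I are indexed by the sets with 1 <= s < k. *)
Section Whitehead.
Variables (k : nat) (d : 'I_k -> int).

Definition proper_index :=
  {I : {set 'I_k} | (I != set0) && (I != [set: 'I_k])}.

Definition udeg (I : {set 'I_k}) : int := \sum_(i in I) (d i + 1) - 1.

Definition whL : gradedLieType := freelie (fun I : proper_index => udeg (val I)).

(* The value 0 is only taken at the two sets which are not generator indices;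
   these do not occur in wh_rhs below, where 1 <= p < #|I|. *)
Definition ugen (I : {set 'I_k}) : whL :=
  if insub I is Some J then fgen _ J else 0.

Section Splitting.
Variables (I : {set 'I_k}) (p : nat) (sigma : 'S_#|I|).
Definition lblock := [set enum_val (sigma a) | a : 'I_#|I| & (a < p)%N].
Definition rblock := [set enum_val (sigma a) | a : 'I_#|I| & (p <= a)%N].
End Splitting.

(* The formula for the differential of u_I, with n_i = d i + 1.  For I the full
   set it is the cycle omega. *)
Definition wh_rhs (I : {set 'I_k}) : whL :=
  \sum_(1 <= p < #|I|)
    \sum_(sigma : 'S_#|I| | shuffle p sigma && fixes_first sigma)
      (signz (udeg (lblock p sigma)) *
       koszul (fun a : 'I_#|I| => d (enum_val a) + 1) sigma) *:
      lbr (ugen (lblock p sigma)) (ugen (rblock p sigma)).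

Lemma homog_ugen I : homog (udeg I) (ugen I).
Proof.
rewrite /ugen; case: insubP => [J _ <-|_]; first exact: homog_fgen.
exact: homog0.
Qed.

Lemma udeg_blocks (I : {set 'I_k}) p (sigma : 'S_#|I|) :
  udeg (lblock p sigma) + udeg (rblock p sigma) = udeg I - 1.
Proof.
have inj : injective (fun a => enum_val (sigma a)).
  by move=> a b /enum_val_inj/perm_inj.
rewrite /udeg addrACA -[RHS]addrA; congr (_ + _).
rewrite !big_imset /=; try by move=> a b _ _; apply: inj.
rewrite [RHS]big_enum_val [RHS](reindex_inj (@perm_inj _ sigma)) /=.
rewrite [RHS](bigID (fun a : 'I_#|I| => (a < p)%N)) /=; congr (_ + _).
  by apply: eq_bigl => a; rewrite inE.
by apply: eq_bigl => a; rewrite inE -leqNgt.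
Qed.

Lemma homog_wh_rhs I : homog (udeg I - 1) (wh_rhs I).
Proof.
apply: homog_sum => p _; apply: homog_sum => sigma _; apply: homogZ.
by rewrite -(udeg_blocks p sigma); apply: lbr_homog; apply: homog_ugen.
Qed.

Definition wh_diff : whL -> whL :=
  fder (fun J : proper_index => homog_wh_rhs (val J)).

Definition wh_omega : whL := wh_rhs [set: 'I_k].

(* phi ranges over the DGL morphisms of degree 0 from (L(U), wh_diff) to L.  That
   wh_diff squares to zero is not needed to say so. *)
Definition whitehead (L : dgLieType) (x : 'I_k -> homology L)
    (h : homology L) : Prop :=
  exists phi : {linear whL -> L},
    [/\ forall n y, homog n y -> homog n (phi y),
        forall y z, phi (lbr y z) = lbr (phi y) (phi z),
        forall y, phi (wh_diff y) = ldiff (phi y),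
        forall j, exists2 z : cycle L, cval z = phi (ugen [set j]) & hclass z = x j
      & exists2 z : cycle L, cval z = phi wh_omega & hclass z = h].

End Whitehead.

(* Planar binary rooted trees. *)
Inductive btree := Leaf | Node of btree & btree.

Fixpoint leaves (T : btree) : nat :=
  if T is Node A B then (leaves A + leaves B)%N else 1%N.

Fixpoint tree_iso (T T' : btree) : bool :=
  match T, T' with
  | Leaf, Leaf => true
  | Node A B, Node A' B' =>
      (tree_iso A A' && tree_iso B B') || (tree_iso A B' && tree_iso B A')
  | _, _ => false
  end.

(* A choice of one planar drawing in each isomorphism class of binary rooted
   trees with k leaves. *)
Definition drawing (k : nat) (ts : seq btree) : Prop :=
  [/\ all (fun T => leaves T == k) ts,
      pairwise (fun T T' => ~~ tree_iso T T') ts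
    & forall T, leaves T = k -> has (tree_iso T) ts].

Fixpoint vertex (T : btree) : finType :=
  if T is Node A B then option (vertex A + vertex B)%type else unit.

Definition root (T : btree) : vertex T :=
  if T is Node _ _ then None else tt.

Fixpoint edge (T : btree) : rel (vertex T) :=
  match T return rel (vertex T) with
  | Leaf => fun _ _ => false
  | Node A B => fun u v =>
      match u, v with
      | None, Some (inl y) => y == root A
      | None, Some (inr y) => y == root B
      | Some (inl x), Some (inl y) => edge x y
      | Some (inr x), Some (inr y) => edge x y
      | _, _ => false
      end
  end.

(* The automorphism group of the underlying (non planar) rooted tree. *)
Definition tree_aut (T : btree) : {set {perm vertex T}} :=
  [set f : {perm vertex T} | (f (root T) == root T) &&
     [forall u, forall v, edge (f u) (f v) == edge u v]].

Lemma btree_comparable : comparable btree.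
Proof. by move=> T T'; rewrite /decidable; decide equality. Defined.
HB.instance Definition _ := hasDecEq.Build btree (compareP btree_comparable).

Lemma tree_iso_refl T : tree_iso T T.
Proof. by elim: T => //= A -> B ->. Qed.

Lemma leaves_gt0 T : (0 < leaves T)%N.
Proof. by elim: T => //= A hA B _; rewrite addn_gt0 hA. Qed.

Fixpoint trees_upto (n : nat) : seq btree :=
  if n is m.+1 then
    Leaf :: [seq Node T T' | T <- trees_upto m, T' <- trees_upto m]
  else [:: Leaf].

Fixpoint tree_dedup (ts : seq btree) : seq btree :=
  if ts is T :: ts' then
    if has (tree_iso T) (tree_dedup ts') then tree_dedup ts'
    else T :: tree_dedup ts'
  else [::].

Lemma mem_trees_upto T n : (leaves T <= n.+1)%N -> T \in trees_upto n.
Proof.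
elim: T n => [|A IHA B IHB] [|n] /= le_n; rewrite inE ?eqxx //.
  by have := leaves_gt0 A; have := leaves_gt0 B; lia.
apply/orP; right; apply: allpairs_f; [apply: IHA|apply: IHB].
  by have := leaves_gt0 B; lia.
by have := leaves_gt0 A; lia.
Qed.

Lemma drawing_exists k : exists ts, drawing k ts.
Proof.
exists (tree_dedup [seq T <- trees_upto k | leaves T == k]).
have : all (fun T => leaves T == k) [seq T <- trees_upto k | leaves T == k].
  exact: filter_all.
have : forall T, leaves T = k -> T \in [seq T <- trees_upto k | leaves T == k].
  by move=> T Tk; rewrite mem_filter Tk eqxx mem_trees_upto // Tk.
move: [seq T <- trees_upto k | leaves T == k] => s mem_s all_s.
split; last 1 first.
- move=> T /mem_s; elim: s {mem_s all_s} => //= T' s IHs; rewrite inE.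
  case/predU1P => [->|/IHs hT]; last by case: ifP => //= _; rewrite hT orbT.
  by case: ifP => //= _; rewrite tree_iso_refl.
- elim: s all_s {mem_s} => //= T s IHs /andP[Tk /IHs sk].
  by case: ifP => //= _; rewrite Tk.
elim: s {mem_s all_s} => //= T s IHs; case: ifP => //= /negbT.
by rewrite -all_predC => ->.
Qed.

(* By hr_i_class the map i induces the identity on homology, so it is a
   quasi-isomorphism. *)
Record homotopy_retract (L : dgLieType) := HomotopyRetract {
  hr_i : {linear homology L -> L};
  hr_q : {linear L -> homology L};
  hr_K : {linear L -> L};
  hr_i_homog : forall n h, homog n h -> homog n (hr_i h);
  hr_q_homog : forall n y, homog n y -> homog n (hr_q y);
  hr_K_homog : forall n y, homog n y -> homog (n + 1) (hr_K y);
  hr_i_chain : forall h, ldiff (hr_i h) = 0;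
  hr_q_chain : forall y, hr_q (ldiff y) = 0;
  hr_i_class : forall h (z : cycle L), cval z = hr_i h -> hclass z = h;
  hr_qi : forall h, hr_q (hr_i h) = h;
  hr_homotopy : forall y,
    y - hr_i (hr_q y) = ldiff (hr_K y) + hr_K (ldiff y)
}.

Section Transfer.
Variables (L : dgLieType) (r : homotopy_retract L).

(* The number of labels K in a branch with underlying tree T, including the one
   on the edge below its root vertex; it is the degree of the map of the branch. *)
Fixpoint Kcount (T : btree) : nat :=
  if T is Node A B then (Kcount A + Kcount B).+1 else 0%N.

Definition branch (T : btree) (y : L) : L := if T is Node _ _ then hr_K r y else y.

(* The image of w_1 (x) ... (x) w_k, given as the list of pairs (|w_a|, w_a).  At
   a vertex the map is (-1)^(p-1) [ , ] o (f (x) g), with f and g the maps of the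
   two branches, and (f (x) g)(a (x) b) = (-1)^(|g||a|) f(a) (x) g(b). *)
Fixpoint tree_map (T : btree) (w : seq (int * homology L)) : L :=
  if T is Node A B then
    let p := leaves A in
    ((-1) ^+ p.-1 * signz ((Kcount B)%:Z * \sum_(v <- take p w) v.1)) *:
      lbr (branch A (tree_map A (take p w))) (branch B (tree_map B (drop p w)))
  else hr_i r (head (0, 0) w).2.

(* l_k on v_1 (x) ... (x) v_k; meaningful only if each v_a is homogeneous of
   degree d a, as the signs depend on d.  Since such tensors span the k-th tensor
   power of H, they determine l_k, its image and its vanishing. *)
Definition ell (ts : seq btree) (k : nat) (d : 'I_k -> int)
    (v : 'I_k -> homology L) : homology L :=
  if (k < 2)%N then 0 else
  \sum_(T <- ts) (#|tree_aut T|%:R : rat)^-1 *: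
    \sum_(sigma : 'S_k) ((-1) ^+ sigma * koszul d sigma) *:
      hr_q r (tree_map T [seq (d (sigma a), v (sigma a)) | a <- enum 'I_k]).

Definition ell_vanishes (ts : seq btree) (k : nat) : Prop :=
  forall (d : 'I_k -> int) (v : 'I_k -> homology L),
    (forall a, homog (d a) (v a)) -> ell ts d v = 0.

Definition im_ell (ts : seq btree) (k : nat) (h : homology L) : Prop :=
  exists (n : nat) (d : 'I_n -> 'I_k -> int) (v : 'I_n -> 'I_k -> homology L),
    (forall m a, homog (d m a) (v m a)) /\
    h = \sum_(m < n) ell ts (d m) (v m).

Definition sum_im_ell (TT : nat -> seq btree) (k : nat) (h : homology L) : Prop :=
  exists2 g : nat -> homology L,
    forall j, (1 <= j < k)%N -> im_ell (TT j) j (g j)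
    & h = \sum_(1 <= j < k) g j.

End Transfer.

(* Main.v *)
Require Import Defs.
From HB Require Import structures.
From mathcomp Require Import all_boot all_order perm all_algebra.
From mathcomp Require Import zify ring.
From mathcomp Require boolp.

Set Implicit Arguments.
Unset Strict Implicit.
Unset Printing Implicit Defensive.

Import GRing.Theory Num.Theory.
Local Open Scope ring_scope.

(** Why the theorem holds.  Attach to the classes x_1, ..., x_k symbols e_1, ..., e_k
    of degrees -n_1, ..., -n_k with e_i ^ 2 = 0, and let E be the graded commutative
    algebra that they generate; its basis is indexed by the subsets I of {1, ..., k}.
    A family a_I in L with |a_I| = |u_I| is an element of degree -1 of L (x) E, and
    1/2 [a, a] is, up to signs, the convolution [conv].  A DGL morphism phi on the
    free model is a family a_I = phi u_I on the proper subsets with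
    d a_I = 1/2 [a, a]_I, i.e. a Maurer-Cartan element up to the top component, and
    phi omega = 1/2 [a, a]_top is the obstruction to extending it
    ([wh_rhs_conv], [curvature_morphism]).

    A gauge transformation along c e_I is affine in c because e_I ^ 2 = 0: it adds
    -dc at I and, up to sign, [c, a_(J - I)] at the J containing I, and it does not
    change the curvature d a - 1/2 [a, a] of such a family ([curvature_gauge]).
    Taking c = K a_I and treating the subsets by increasing size one reaches a family
    with a_I = i q a_I + K d a_I for every proper I ([normalise]), without changing
    the class of the obstruction or the classes q a_{j} = x_j.

    For such a family a = i h + K (1/2 [a, a]) with h = q a.  Unfolding this recursion
    writes a, and then 1/2 [a, a]_top, as a sum over all planar binary trees whose
    leaves carry the h_I, one factor 1/2 for each vertex ([tree_expansion],
    [half_conv_trees]).  Expanding the convolutions turns a tree with j leaves into a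
    sum over ordered partitions of {1, ..., k} into j blocks ([tree_conv_psum],
    [psum_partE]).

    Apply q and collect the trees with j leaves.  Averaging over the reorderings of
    the blocks produces the antisymmetrisation in ell_j ([psum_average]).  The
    factors 1/2 become the factors 1 / |Aut T|, because a tree T with j leaves has
    2 ^ (j - 1) / |Aut T| planar drawings ([sum_drawing]).  The signs agree because
    the shifted bracket and K have total degree 0, so that the tree maps on shifted
    degrees carry no signs besides the Koszul sign of the permutation, while
    desuspension contributes the same factor theta for every tree
    ([tree_map_stree], [decalage], [theta_ell]).  So for j < k the part with j leaves
    lies in Im ell_j ([leaf_partE]); for j = k all blocks are singletons and the part
    is epsilon ell_k (x_1, ..., x_k), where epsilon = theta d ([leaf_part_top],
    [thetaE]); for j > k some block is empty and h vanishes on it.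

    If the lower brackets vanish then so does Gamma, and the given element of the
    Whitehead set is epsilon ell_k (x_1, ..., x_k). *)

(** * Signs of permutations *)

Lemma signzN n : signz (- n) = signz n.
Proof. by rewrite /signz -exprz_inv invrN1. Qed.

Lemma signz0 : signz 0 = 1.
Proof. by rewrite /signz expr0z. Qed.

Lemma signz1 : signz 1 = -1.
Proof. by rewrite /signz expr1z. Qed.

Lemma signz_sum (I : Type) (s : seq I) (P : pred I) (F : I -> int) :
  signz (\sum_(i <- s | P i) F i) = \prod_(i <- s | P i) signz (F i).
Proof. exact: (big_morph signz signzM signz0). Qed.

(** A product over unordered pairs does not change when its indices are permuted:
    the inverted pairs are the ones to be read backwards. *)
Lemma prod_inversions (R : comPzRingType) s (G : 'I_s -> 'I_s -> R) (sigma : 'S_s) :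
  \prod_(a < s) \prod_(b < s | (a < b)%N)
     (if (sigma a < sigma b)%N then G (sigma a) (sigma b)
      else G (sigma b) (sigma a)) =
  \prod_(a < s) \prod_(b < s | (a < b)%N) G a b.
Proof.
rewrite !pair_big_dep /=.
pose swap (u : 'I_s * 'I_s) := (u.2, u.1).
pose act (u : 'I_s * 'I_s) := (sigma u.1, sigma u.2).
have swapK : involutive swap by case.
have act_inj : injective act.
  by move=> [a b] [c e] [] /perm_inj -> /perm_inj ->.
rewrite (bigID (fun u : 'I_s * 'I_s => (sigma u.1 < sigma u.2)%N)) /=.
rewrite [RHS](reindex_inj act_inj) [RHS](bigID (fun u : 'I_s * 'I_s => (u.1 < u.2)%N)) /=.
congr (_ * _).
  by apply: eq_big => u; [rewrite andbC|move=> /andP[_ ->]].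
rewrite [RHS](reindex_inj (inv_inj swapK)) /=; apply: eq_big => -[a b] /=.
  have [->|nab] := eqVneq a b; first by rewrite !ltnn.
  have nab' : nat_of_ord b != a by rewrite eq_sym.
  have nsab : nat_of_ord (sigma b) != sigma a.
    by apply: contra nab' => /eqP/val_inj/perm_inj ->.
  by move: nab' nsab; case: ltngtP => // _; case: ltngtP.
by move=> /andP[_ /negPf ->].
Qed.

(** The Vandermonde determinant at 0, ..., s - 1 is a nonzero product over pairs that
    is multiplied by the signature when its columns are permuted. *)
Lemma odd_perm_inversions s (sigma : 'S_s) :
  (-1) ^+ sigma =
  \prod_(a < s) \prod_(b < s | (a < b)%N && (sigma b < sigma a)%N) (-1 : rat).
Proof.
pose x : 'rV[rat]_s := \row_i i%:R.
pose V := Vandermonde s x.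
have nzV : \det V != 0.
  rewrite det_Vandermonde; apply/prodf_neq0 => a _; apply/prodf_neq0 => b ab.
  by rewrite !mxE subr_eq0 eqr_nat gtn_eqF.
apply: (mulIf nzV).
have -> : (-1) ^+ sigma * \det V = \det (col_perm sigma V).
  by rewrite col_permE det_mulmx det_perm odd_permV mulrC.
have -> : col_perm sigma V = Vandermonde s (\row_i x 0 (sigma i)).
  by apply/matrixP => i j; rewrite !mxE.
rewrite !det_Vandermonde -[X in _ = _ * X](prod_inversions _ sigma) -big_split /=.
apply: eq_bigr => a _; rewrite big_mkcondr -big_split /=.
apply: eq_bigr => b ab; rewrite !mxE.
have [sab|sab|/val_inj/perm_inj sab] := ltngtP (sigma b) (sigma a).
- by rewrite mulN1r opprB.
- by rewrite mul1r.

by rewrite sab ltnn in ab.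
Qed.

(** The sign of desuspending s symbols: the a-th one passes the s - a - 1 suspensions
    to its right. *)
Definition theta s (d : 'I_s -> int) : rat :=
  \prod_(a < s) \prod_(b < s | (a < b)%N) signz (d a).

Lemma thetaK s (d : 'I_s -> int) : theta d * theta d = 1.
Proof.
rewrite /theta -big_split big1 //= => a _; rewrite -big_split big1 //= => b _.
exact: signzK.
Qed.

(** An inversion of degrees p and q contributes -(-1)^(pq) on the unsuspended side and
    (-1)^((p+1)(q+1)) on the suspended one; the quotient (-1)^(p+q) is what the two
    desuspension signs differ by. *)
Lemma decalage s (d : 'I_s -> int) (sigma : 'S_s) :
  (-1) ^+ sigma * koszul d sigma * theta (fun a => d (sigma a)) =
  theta d * koszul (fun a => d a + 1) sigma.
Proof.
rewrite odd_perm_inversions /theta /koszul.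
rewrite -[X in _ = X * _](prod_inversions (fun a b => signz (d a)) sigma).
rewrite -!big_split /=; apply: eq_bigr => a _.
rewrite !big_mkcondr /= -!big_split /=; apply: eq_bigr => b ab.
have [sab|sab|sab] := ltngtP (sigma b) (sigma a).
- rewrite mulrDl mulrDr !mulr1 mul1r !signzM signz1.
  by rewrite !mulrA -!(mulrAC _ (signz (d (sigma b)))) signzK; ring.
- by rewrite mul1r mulr1.
by move/val_inj/perm_inj: sab => E; rewrite E ltnn in ab.
Qed.

(** * Shuffle signs of subsets *)

Lemma big_disjU (R : Type) (idx : R) (op : Monoid.com_law idx) (I : finType)
    (X Y : {set I}) (F : I -> R) : [disjoint X & Y] ->
  \big[op/idx]_(i in X :|: Y) F i =
  op (\big[op/idx]_(i in X) F i) (\big[op/idx]_(i in Y) F i).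
Proof. by move=> dXY; rewrite -bigU //; apply: eq_bigl => i; rewrite !inE. Qed.

Section SetSigns.
Variables (k : nat) (d : 'I_k -> int).
Implicit Types X Y Z I : {set 'I_k}.

(** The Koszul sign of e_X e_Y = kap X Y * e_(X U Y), for symbols e_i of degrees
    d i + 1. *)
Definition kap X Y : rat :=
  \prod_(x in X) \prod_(y in Y | (y < x)%N) signz ((d x + 1) * (d y + 1)).

Lemma kapE X Y : kap X Y =
  \prod_(x in X) \prod_(y in Y)
     (if (y < x)%N then signz ((d x + 1) * (d y + 1)) else 1).
Proof. by apply: eq_bigr => x _; rewrite big_mkcondr. Qed.

Lemma kapK X Y : kap X Y * kap X Y = 1.
Proof.
rewrite /kap -big_split big1 //= => a _; rewrite -big_split big1 //= => b _.
exact: signzK.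
Qed.

Lemma kap0X Y : kap set0 Y = 1.
Proof. by rewrite /kap big_set0. Qed.

Lemma kapX0 X : kap X set0 = 1.
Proof. by rewrite kapE big1 // => x _; rewrite big_set0. Qed.

Lemma kapUl X Y Z : [disjoint X & Y] -> kap (X :|: Y) Z = kap X Z * kap Y Z.
Proof. by move=> dXY; rewrite /kap big_disjU. Qed.

Lemma kapUr X Y Z : [disjoint X & Y] -> kap Z (X :|: Y) = kap Z X * kap Z Y.
Proof.
move=> dXY; rewrite !kapE -big_split; apply: eq_bigr => z _ /=.
by rewrite big_disjU.
Qed.

Lemma udeg1_sum X : udeg d X + 1 = \sum_(i in X) (d i + 1).
Proof. by rewrite /udeg subrK. Qed.

Lemma udegU X Y : [disjoint X & Y] ->
  udeg d (X :|: Y) = udeg d X + udeg d Y + 1.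
Proof. by move=> dXY; rewrite /udeg big_disjU //=; ring. Qed.

Lemma kapC X Y : [disjoint X & Y] ->
  kap X Y * kap Y X = signz ((udeg d X + 1) * (udeg d Y + 1)).
Proof.
move=> dXY; rewrite !udeg1_sum mulr_suml signz_sum kapE.
rewrite [kap Y X]kapE [X in _ * X = _]exchange_big -big_split /=; apply: eq_bigr => x xX /=.
rewrite mulr_sumr signz_sum -big_split; apply: eq_bigr => y yY /=.
have nxy : x != y by apply: contraTneq xX => ->; rewrite (disjointFl dXY).
have [xy|xy|/val_inj xy] := ltngtP x y; rewrite ?mulr1 ?mul1r //.
  by rewrite mulrC.
by rewrite xy eqxx in nxy.
Qed.

End SetSigns.

(** * Convolution of families indexed by subsets *)

HB.instance Definition _ (L : gradedLieType) (x : L) :=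
  GRing.isLinear.Build rat L L *:%R (lbr x) (lbr_linearr x).

Section LbrLeft.
Variable L : gradedLieType.
Implicit Types x y z : L.

(** A named constant on which the linear structure in the left argument can be
    declared. *)
Definition lbrl y x := lbr x y.
HB.instance Definition _ y :=
  GRing.isLinear.Build rat L L *:%R (lbrl y) (lbr_linearl y).

Lemma lbr0l y : lbr 0 y = 0.
Proof. exact: (linear0 (lbrl y)). Qed.

Lemma lbrDl y x z : lbr (x + z) y = lbr x y + lbr z y.
Proof. exact: (linearD (lbrl y)). Qed.

Lemma lbrNl y x : lbr (- x) y = - lbr x y.
Proof. exact: (linearN (lbrl y)). Qed.

Lemma lbrZl c y x : lbr (c *: x) y = c *: lbr x y.
Proof. exact: (linearZ_LR (lbrl y)). Qed.

Lemma lbr_suml (I : Type) (s : seq I) (P : pred I) (F : I -> L) y :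
  lbr (\sum_(i <- s | P i) F i) y = \sum_(i <- s | P i) lbr (F i) y.
Proof. exact: (linear_sum (lbrl y)). Qed.

End LbrLeft.

Section Convolution.
Variables (k : nat) (d : 'I_k -> int) (L : gradedLieType).
Implicit Types (X Y Z I : {set 'I_k}) (f g : {set 'I_k} -> L).

(** The bracket of L (x) E in components; the factor signz (udeg X) makes it the
    shifted bracket, which is symmetric on elements of degree -1. *)
Definition conv f g I : L :=
  \sum_(X : {set 'I_k} | X \subset I)
     (kap d X (I :\: X) * signz (udeg d X)) *: lbr (f X) (g (I :\: X)).

Definition homog_family f := forall X, homog (udeg d X) (f X).

Lemma setDSK I X : X \subset I -> I :\: (I :\: X) = X.
Proof. by move=> XI; rewrite setDDr setDv set0U; apply/setIidPr. Qed.

Lemma disjointD I X : [disjoint X & I :\: X].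
Proof.
by rewrite -setI_eq0; apply/eqP/setP=> i; rewrite !inE; case: (i \in X).
Qed.

Lemma setUDK I X : X \subset I -> X :|: (I :\: X) = I.
Proof.
move=> /subsetP XI; apply/setP=> i; rewrite !inE.
by case iX: (i \in X) => //=; rewrite XI.
Qed.

Lemma big_subsetC (V : nmodType) I (P : pred {set 'I_k}) (F : {set 'I_k} -> V) :
  \sum_(X : {set 'I_k} | (X \subset I) && P X) F X =
  \sum_(X : {set 'I_k} | (X \subset I) && P (I :\: X)) F (I :\: X).
Proof.
rewrite (reindex_onto (fun X => I :\: X) (fun X => I :\: X)) /=; last first.
  by move=> X /andP[XI _]; apply: setDSK.
apply: eq_bigl => X; rewrite subsetDl /= andbC.
have [XI|nXI] := boolP (X \subset I); first by rewrite setDSK // eqxx.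
apply/negP => /andP[/eqP E _]; case/negP: nXI; rewrite -E; apply: subsetDl.
Qed.

(** The antisymmetry sign of the bracket, the two shifting signs and the exchange of
    e_X with its complement cancel out. *)
Lemma conv_termC I X f g : homog_family f -> homog_family g -> X \subset I ->
  (kap d (I :\: X) X * signz (udeg d (I :\: X))) *: lbr (f (I :\: X)) (g X) =
  (kap d X (I :\: X) * signz (udeg d X)) *: lbr (g X) (f (I :\: X)).
Proof.
move=> hf hg XI; rewrite (lbr_anti _ _ _ _ (hf (I :\: X)) (hg X)) scalerN scalerA -scaleNr.
congr (_ *: _); have := kapC d (disjointD I X).
move: (kap d X _) (kapK d X (I :\: X)) => u uK.
move=> /(congr1 ( *%R u)); rewrite mulrA uK mul1r => ->.
move: (udeg d X) (udeg d (I :\: X)) => p q.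
rewrite mulrDl mulrDr mulr1 mul1r !signzM signz1 (mulrC p q).
move: (signz (q * p)) (signzK (q * p)) (signz q) (signzK q) => w wK v vK.
transitivity (u * signz p * (w * w) * (v * v)); first by ring.
by rewrite wK vK !mulr1.
Qed.

Lemma convC f g I : homog_family f -> homog_family g ->
  conv f g I = conv g f I.
Proof.
move=> hf hg; rewrite /conv.
have E (F : {set 'I_k} -> L) : \sum_(X : {set 'I_k} | X \subset I) F X =
    \sum_(X : {set 'I_k} | (X \subset I) && predT X) F X.
  by apply: eq_bigl => X; rewrite andbT.
rewrite E big_subsetC -E; apply: eq_bigr => X XI.
by rewrite setDSK // conv_termC.
Qed.

Lemma homog_conv f g I : homog_family f -> homog_family g ->
  homog (udeg d I - 1) (conv f g I).
Proof.
move=> hf hg; apply: homog_sum => X XI; apply: homogZ.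
have -> : udeg d I - 1 = udeg d X + udeg d (I :\: X).
  by rewrite -{1}(setUDK XI) udegU ?disjointD // addrK.
exact: lbr_homog.
Qed.

Lemma conv_suml (J : Type) (s : seq J) (c : J -> rat) (f : J -> {set 'I_k} -> L) g I :
  conv (fun X => \sum_(j <- s) c j *: f j X) g I = \sum_(j <- s) c j *: conv (f j) g I.
Proof.
rewrite /conv; under [RHS]eq_bigr do rewrite scaler_sumr.
rewrite exchange_big; apply: eq_bigr => X XI /=.
rewrite lbr_suml scaler_sumr; apply: eq_bigr => j _.
by rewrite lbrZl !scalerA mulrC.
Qed.

Lemma conv_sumr (J : Type) (s : seq J) (c : J -> rat) f (g : J -> {set 'I_k} -> L) I :
  conv f (fun X => \sum_(j <- s) c j *: g j X) I = \sum_(j <- s) c j *: conv f (g j) I.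
Proof.
rewrite /conv; under [RHS]eq_bigr do rewrite scaler_sumr.
rewrite exchange_big; apply: eq_bigr => X XI /=.
rewrite linear_sum scaler_sumr; apply: eq_bigr => j _.
by rewrite linearZ_LR !scalerA mulrC.
Qed.

(** The value at I itself only meets the value at the empty set. *)
Lemma eq_conv f f' g g' I : f set0 = 0 -> f' set0 = 0 -> g set0 = 0 -> g' set0 = 0 ->
  (forall X, X \proper I -> f X = f' X) -> (forall X, X \proper I -> g X = g' X) ->
  conv f g I = conv f' g' I.
Proof.
move=> f0 f'0 g0 g'0 ff' gg'; apply: eq_bigr => X XI.
have [->|X0] := eqVneq X set0; first by rewrite f0 f'0 !lbr0l.
have [->|XnI] := eqVneq X I; first by rewrite setDv g0 g'0 !linear0.
rewrite ff' ?gg' //; last by rewrite properEneq XnI.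
rewrite properEneq subsetDl andbT; apply: contraNneq X0 => E.
by rewrite -(setDSK XI) E setDv.
Qed.

Lemma conv_set0 f g : f set0 = 0 -> conv f g set0 = 0.
Proof.
move=> f0; rewrite /conv big1 // => X; rewrite subset0 => /eqP ->.
by rewrite f0 lbr0l scaler0.
Qed.

(** Taking complements in I exchanges the subsets that contain i with the other ones
    and preserves the terms. *)
Lemma conv_half f I i : homog_family f -> i \in I ->
  conv f f I = 2%:R *: \sum_(X : {set 'I_k} | (X \subset I) && (i \in X))
     (kap d X (I :\: X) * signz (udeg d X)) *: lbr (f X) (f (I :\: X)).
Proof.
move=> hf iI; rewrite /conv (bigID (fun X : {set 'I_k} => i \in X)) /=.
rewrite scaler_nat mulr2n; congr (_ + _).
rewrite (big_subsetC I (fun X => i \notin X)).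
apply: eq_big => [X|X /andP[XI _]]; first by rewrite !inE iI andbT negbK.
by rewrite setDSK // conv_termC.
Qed.

End Convolution.

(** * Shuffles and subsets *)

Lemma nth_enum_ord_lt k (A : {pred 'I_k}) x0 i j :
  (i < j < #|A|)%N -> (nth x0 (enum A) i < nth x0 (enum A) j)%N.
Proof.
move=> /andP[ij jA].
have tr : transitive (relpre (@nat_of_ord k) ltn) by move=> a b c; apply: ltn_trans.
have srt : sorted (relpre (@nat_of_ord k) ltn) (enum A).
  rewrite /enum_mem; apply: sorted_filter => //.
  by rewrite -sorted_map -enumT val_enum_ord iota_ltn_sorted.
by apply: (sorted_ltn_nth tr x0 srt); rewrite // !inE -cardE // (ltn_trans ij).
Qed.

Lemma enum_val_mono k (I : {set 'I_k}) :
  {mono (@enum_val _ (mem I)) : a b / (a < b)%N}.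
Proof.
have lt (a b : 'I_#|I|) : (a < b)%N -> (enum_val a < enum_val b)%N.
  move=> ab; rewrite (enum_val_nth (enum_val a)) (enum_val_nth (enum_val a) b).
  by rewrite nth_enum_ord_lt // ab ltn_ord.
move=> a b; have [ab|ba|/val_inj ->] := ltngtP a b; last by rewrite ltnn.
  exact: lt.
by apply/negbTE; rewrite -leqNgt ltnW // lt.
Qed.

(** At the first position where two increasing enumerations of the same set differ,
    the larger value skips the smaller one. *)
Lemma increasing_perm_eq s (P : pred 'I_s) (sigma tau : 'S_s) :
  (forall a b, P a -> P b -> (a < b)%N -> (sigma a < sigma b)%N) ->
  (forall a b, P a -> P b -> (a < b)%N -> (tau a < tau b)%N) ->
  (forall a, P a -> exists2 b, P b & sigma a = tau b) ->
  (forall a, P a -> exists2 b, P b & tau a = sigma b) ->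
  forall a, P a -> sigma a = tau a.
Proof.
move=> si ti st ts a; have [n] := ubnP a; elim: n a => // n IHn a /ltnSE le_an Pa.
have [b Pb sb] := st a Pa; have [c Pc tc] := ts a Pa.
have [ba|ab|/val_inj ba] := ltngtP b a; last by rewrite sb ba.
  have := IHn b (leq_trans ba le_an) Pb; rewrite -sb => /perm_inj E.
  by rewrite E ltnn in ba.
have [ca|ac|/val_inj ca] := ltngtP c a; last by rewrite tc ca.
  have := IHn c (leq_trans ca le_an) Pc; rewrite -tc => /perm_inj E.
  by rewrite E ltnn in ca.
have := si a c Pa Pc ac; have := ti a b Pa Pb ab.
by rewrite -tc -sb => h1 h2; have := ltn_trans h1 h2; rewrite ltnn.
Qed.

Section Shuffles.
Variables (k : nat) (I : {set 'I_k}) (p : nat).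
Local Notation s := #|I|.
Implicit Types (sigma tau : 'S_s) (X : {set 'I_k}) (a b : 'I_s).

Lemma shuffle_left sigma a b : shuffle p sigma ->
  (b < p)%N -> (a < b)%N -> (sigma a < sigma b)%N.
Proof.
by move=> /forallP/(_ a)/forallP/(_ b)/implyP h bp ab; apply: h; rewrite ab bp.
Qed.

Lemma shuffle_right sigma a b : shuffle p sigma ->
  (p <= a)%N -> (a < b)%N -> (sigma a < sigma b)%N.
Proof.
by move=> /forallP/(_ a)/forallP/(_ b)/implyP h bp ab; apply: h; rewrite ab bp orbT.
Qed.

Lemma lblockP sigma a : (enum_val (sigma a) \in lblock p sigma) = (a < p)%N.
Proof.
apply/imsetP/idP => [[b] | ap]; last by exists a; rewrite ?inE.
by rewrite inE => bp /enum_val_inj/perm_inj ->.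
Qed.

Lemma rblockP sigma a : (enum_val (sigma a) \in rblock p sigma) = (p <= a)%N.
Proof.
apply/imsetP/idP => [[b] | ap]; last by exists a; rewrite ?inE.
by rewrite inE => bp /enum_val_inj/perm_inj ->.
Qed.

Lemma enum_val_perm_surj sigma i : i \in I -> exists a, i = enum_val (sigma a).
Proof.
move=> iI; exists ((sigma^-1)%g (enum_rank_in iI i)).
by rewrite permKV enum_rankK_in.
Qed.

Lemma lblock_sub sigma : lblock p sigma \subset I.
Proof. by apply/subsetP => i /imsetP[a _ ->]; apply: enum_valP. Qed.

Lemma rblockE sigma : rblock p sigma = I :\: lblock p sigma.
Proof.
apply/setP => i; rewrite inE; have [iI|iI] := boolP (i \in I).
  by have [a ->] := enum_val_perm_surj sigma iI; rewrite lblockP rblockP leqNgt andbT.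
rewrite andbF; apply/negbTE; apply: contra iI => /imsetP[a _ ->].
exact: enum_valP.
Qed.

Lemma card_lblock sigma : (p <= s)%N -> #|lblock p sigma| = p.
Proof.
move=> ps; rewrite card_imset => [|a b /enum_val_inj/perm_inj //].
have -> : [set a : 'I_s | (a < p)%N] = [set widen_ord ps i | i in [set: 'I_p]].
  apply/setP => a; rewrite inE; apply/idP/imsetP => [ap|[b _ ->]]; last exact: (ltn_ord b).
  by exists (Ordinal ap); rewrite ?inE //; apply: val_inj.
by rewrite card_imset ?cardsT ?card_ord // => a b /(congr1 val) /= /val_inj.
Qed.

(** A shuffle is determined by its left block, since it enumerates this block and its
    complement increasingly. *)
Lemma shuffle_inj :
  {in [pred sigma | shuffle p sigma] &, injective (fun sigma => lblock p sigma)}.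
Proof.
have aux sigma tau a : lblock p sigma = lblock p tau ->
    exists2 b : 'I_s, (b < p)%N = (a < p)%N & sigma a = tau b.
  move=> E; exists ((tau^-1)%g (sigma a)); last by rewrite permKV.
  by rewrite -(lblockP tau) -(lblockP sigma) permKV E.
move=> sigma tau; rewrite !inE => ss st E; apply/permP => a.
have [ap|pa] := ltnP a p.
  apply: (@increasing_perm_eq _ (fun a => (a < p)%N)) (ap).
  - by move=> b c _ cp bc; apply: shuffle_left bc.
  - by move=> b c _ cp bc; apply: shuffle_left bc.
  - by move=> b bp; have [c cp ->] := aux _ _ b E; exists c; rewrite ?cp.
  - by move=> b bp; have [c cp ->] := aux _ _ b (esym E); exists c; rewrite ?cp.
apply: (@increasing_perm_eq _ (fun a => (p <= a)%N)) (pa).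
- by move=> b c pb _ bc; apply: shuffle_right bc.
- by move=> b c pb _ bc; apply: shuffle_right bc.
- by move=> b bp; have [c cp ->] := aux _ _ b E; exists c; rewrite // leqNgt cp -leqNgt.
- by move=> b bp; have [c cp ->] := aux _ _ b (esym E); exists c; rewrite // leqNgt cp -leqNgt.
Qed.

(** Listing the elements of X and then the other ones gives the shuffle. *)
Lemma shuffle_surj X : X \subset I -> #|X| = p ->
  exists2 sigma : 'S_s, shuffle p sigma & lblock p sigma = X.
Proof.
move=> XI Xp; pose J := [set b : 'I_s | enum_val b \in X].
have Jp : #|J| = p.
  rewrite -Xp -(card_imset _ (@enum_val_inj _ (mem I))); apply: eq_card => i.
  apply/imsetP/idP => [[b]|iX]; first by rewrite inE => bX ->.
  have [b Eb] := enum_val_perm_surj 1%g (subsetP XI i iX).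
  by exists ((1%g : 'S_s) b); rewrite // inE -Eb.
pose l := enum J ++ enum (~: J).
have sl : size l = s by rewrite size_cat -!cardE cardsC card_ord.
have ul : uniq l.
  rewrite cat_uniq !enum_uniq andbT /= -all_predC; apply/allP => b /=.
  by rewrite !mem_enum inE.
have injf : injective (fun a : 'I_s => nth a l a).
  move=> a b; rewrite (set_nth_default b) ?sl // => /eqP.
  by rewrite nth_uniq ?sl // => /eqP/val_inj.
pose sigma := perm injf.
have sE x0 (a : 'I_s) : sigma a =
    if (a < p)%N then nth x0 (enum J) a else nth x0 (enum (~: J)) (a - p).
  by rewrite permE (set_nth_default x0) ?sl // nth_cat -cardE Jp.
have pC : (#|~: J| + p = s)%N by rewrite -Jp addnC cardsC card_ord.
exists sigma.
  apply/forallP => a; apply/forallP => b; apply/implyP => /andP[ab].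
  rewrite !(sE a); case/orP => [bp|pa].
    by rewrite bp (ltn_trans ab bp) nth_enum_ord_lt // ab Jp.
  rewrite !ltnNge pa (leq_trans pa (ltnW ab)) /= -ltnNge nth_enum_ord_lt //.
  have aux (i j n m q : nat) : (m + q = n -> j < n -> q <= i -> i < j -> i - q < j - q < m)%N by lia.
  exact: aux pC (ltn_ord b) pa ab.
apply/setP => i; have [iI|niI] := boolP (i \in I); last first.
  have -> : (i \in X) = false by apply: contraNF niI; apply: (subsetP XI).
  by apply: contraNF niI; apply: (subsetP (lblock_sub sigma)).
have [a ->] := enum_val_perm_surj sigma iI; rewrite lblockP.
have -> : (enum_val (sigma a) \in X) = (sigma a \in J) by rewrite inE.
rewrite (sE a); case: ifP => ap; first by rewrite -mem_enum mem_nth // -cardE Jp.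
have : nth a (enum (~: J)) (a - p) \in enum (~: J).
  have aux (j n m q : nat) : (m + q = n -> j < n -> (j < q) = false -> j - q < m)%N by lia.
  by apply: mem_nth; rewrite -cardE; apply: aux pC (ltn_ord a) ap.
by rewrite mem_enum inE => /negbTE ->.
Qed.

Lemma shuffle_fixes_first sigma (i0 : 'I_s) : i0 = 0%N :> nat -> (0 < p)%N ->
  shuffle p sigma -> fixes_first sigma = (enum_val i0 \in lblock p sigma).
Proof.
move=> i00 p0 ss; apply/forallP/idP => [/(_ i0)|].
  rewrite i00 eqxx /= => /eqP E; have {1}<- : sigma i0 = i0 by apply: val_inj; rewrite /= E i00.
  by rewrite lblockP i00.
have [a Ea] := enum_val_perm_surj sigma (enum_valP i0).
rewrite Ea lblockP => ap b; apply/implyP => /eqP b0.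
have -> : b = i0 by apply: val_inj; rewrite /= b0 i00.
have {}Ea : i0 = sigma a by apply: enum_val_inj.
have [a0|a0] := posnP a.
  have -> : i0 = a by apply: val_inj; rewrite /= i00 a0.
  by rewrite -Ea i00.
have := shuffle_left ss ap (_ : i0 < a)%N; rewrite i00 => /(_ a0).
by rewrite -Ea i00.
Qed.

(** All inversions of a shuffle are between the two blocks. *)
Lemma koszul_shuffle (d : 'I_k -> int) sigma : shuffle p sigma ->
  koszul (fun a : 'I_s => d (enum_val a) + 1) sigma =
  kap d (lblock p sigma) (rblock p sigma).
Proof.
move=> ss; have inj : injective (fun a => enum_val (sigma a)).
  by move=> a b /enum_val_inj/perm_inj.
rewrite kapE /koszul big_imset /=; last by move=> a b _ _; apply: inj.
rewrite [RHS]big_mkcond /=; apply: eq_bigr => a _; rewrite inE.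
case: ifP => [ap|/negbT pa].
  rewrite big_imset /=; last by move=> b c _ _; apply: inj.
  rewrite big_mkcond [RHS]big_mkcond; apply: eq_bigr => b _ /=.
  rewrite inE enum_val_mono; have [bp|pb] := ltnP b p.
    have [ab|//] := ltnP a b.
    by have := shuffle_left ss bp ab; rewrite ltnNge leq_eqVlt negb_or => /andP[_ /negbTE ->].
  by rewrite (leq_trans ap pb).
rewrite big1 // => b /andP[ab].
by rewrite ltnNge leq_eqVlt (shuffle_right ss _ ab) ?orbT // leqNgt.
Qed.

Lemma sum_shuffles (V : nmodType) (F : {set 'I_k} -> V) (i0 : 'I_s) :
  i0 = 0%N :> nat -> (0 < p <= s)%N ->
  \sum_(sigma : 'S_s | shuffle p sigma && fixes_first sigma) F (lblock p sigma) =
  \sum_(X : {set 'I_k} | [&& X \subset I, enum_val i0 \in X & #|X| == p]) F X.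
Proof.
move=> i00 /andP[p0 ps].
pose Q := [pred sigma : 'S_s | shuffle p sigma && fixes_first sigma].
have <- : \sum_(X in [set lblock p sigma | sigma in Q]) F X =
    \sum_(sigma in Q) F (lblock p sigma).
  apply: big_imset => sigma tau; rewrite !inE => /andP[ss _] /andP[st _].
  by apply: shuffle_inj.
apply: eq_bigl => X; apply/imsetP/and3P => [[sigma]|[XI i0X /eqP Xp]].
  rewrite inE => /andP[ss fs] ->; split; first exact: lblock_sub.
    by rewrite -shuffle_fixes_first.
  by rewrite card_lblock.
have [sigma ss E] := shuffle_surj XI Xp; exists sigma => //.
by rewrite inE ss (shuffle_fixes_first i00) //= E.
Qed.

End Shuffles.

(** The sum over shuffles with sigma(1) = 1 picks one of the two orders of each
    splitting of I into two blocks, so it is half of a symmetric convolution.  The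
    convolution also has the terms of the two trivial splittings; they vanish because
    [ugen] does at the empty set. *)
Lemma wh_rhs_conv k (d : 'I_k -> int) (I : {set 'I_k}) :
  wh_rhs d I = 2%:R^-1 *: conv d (ugen d) (ugen d) I.
Proof.
have hu : homog_family d (ugen d) by move=> X; apply: homog_ugen.
have u0 : ugen d set0 = 0 by rewrite /ugen; case: insubP => // J /andP[]; rewrite eqxx.
have [I0|] := posnP #|I|.
  rewrite /wh_rhs big_geq ?I0 //; move/eqP: I0; rewrite cards_eq0 => /eqP ->.
  by rewrite conv_set0 ?scaler0.
move=> s0; pose i0 : 'I_#|I| := Ordinal s0.
rewrite (conv_half hu (enum_valP i0)) scalerA mulVf ?scale1r ?pnatr_eq0 //.
pose F X : whL d := (kap d X (I :\: X) * signz (udeg d X)) *: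
  lbr (ugen d X) (ugen d (I :\: X)).
transitivity (\sum_(1 <= p < #|I|) \sum_(X : {set 'I_k} |
    [&& X \subset I, enum_val i0 \in X & #|X| == p]) F X).
  apply: eq_big_nat => p /andP[p0 ps]; rewrite -sum_shuffles ?p0 ?(ltnW ps) //.
  apply: eq_bigr => sigma /andP[ss _].
  by rewrite (koszul_shuffle d ss) rblockE mulrC.
rewrite (exchange_big_dep (fun X : {set 'I_k} => (X \subset I) && (enum_val i0 \in X))) /=; last first.
  by move=> p X _ /and3P[-> ->].
apply: eq_bigr => X /andP[XI i0X]; rewrite XI i0X /=.
have [->|XnI] := eqVneq X I.
  rewrite big_nat_cond big_pred0 ?setDv ?u0 ?linear0 ?scaler0 // => p.
  by apply/negbTE/negP => /andP[/andP[_ pI] /eqP E]; rewrite E ltnn in pI.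
have XpI : (#|X| < #|I|)%N by apply: proper_card; rewrite properEneq XnI.
have X0 : (0 < #|X|)%N by apply/card_gt0P; exists (enum_val i0).
rewrite (big_nat_widenl _ 0) // big_mkord.
rewrite (bigD1 (Ordinal XpI)) /= ?eqxx ?X0 // big1 ?addr0 // => p /andP[/andP[/eqP E _]].
by rewrite -val_eqE /= E eqxx.
Qed.

(** * Gauge transformations *)

Section ConvolutionMore.
Variables (k : nat) (d : 'I_k -> int) (L : gradedLieType).
Implicit Types (X Y Z I J M : {set 'I_k}) (f g h : {set 'I_k} -> L).

Lemma convDl f g h I :
  conv d (fun X => f X + g X) h I = conv d f h I + conv d g h I.
Proof.
by rewrite /conv -big_split; apply: eq_bigr => X _; rewrite lbrDl scalerDr.
Qed.

Lemma convDr f g h I :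
  conv d h (fun X => f X + g X) I = conv d h f I + conv d h g I.
Proof.
by rewrite /conv -big_split; apply: eq_bigr => X _; rewrite linearD scalerDr.
Qed.

(** This is e_I ^ 2 = 0. *)
Lemma conv_disjoint0 f g I : I != set0 ->
  (forall X, ~~ (I \subset X) -> f X = 0) ->
  (forall X, ~~ (I \subset X) -> g X = 0) -> forall J, conv d f g J = 0.
Proof.
move=> /set0Pn[i iI] f0 g0 J; rewrite /conv big1 // => X _.
have [IX|nIX] := boolP (I \subset X); last by rewrite f0 // lbr0l scaler0.
rewrite (g0 (J :\: X)) ?linear0 ?scaler0 //.
by apply/subsetPn; exists i; rewrite // inE (subsetP IX i iI).
Qed.

Lemma big_superset (V : nmodType) I J (F : {set 'I_k} -> V) : I \subset J ->
  \sum_(X : {set 'I_k} | (X \subset J) && (I \subset X)) F X =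
  \sum_(Z : {set 'I_k} | Z \subset J :\: I) F (I :|: Z).
Proof.
move=> IJ; rewrite (reindex_onto (fun Z => I :|: Z) (fun X => X :\: I)) /=; last first.
  by move=> X /andP[_ IX]; apply: setUDK.
apply: eq_bigl => Z; rewrite subUset IJ subsetUl andbT /= subsetD.
have [ZJ|//] := boolP (Z \subset J); rewrite /=.
rewrite setDUl setDv set0U; apply/eqP/idP => [<-|dZI]; last exact/setDidPl.
by rewrite disjoint_sym disjointD.
Qed.

(** The Jacobi identity gives the terms with c acting on the left factor and on the
    right one; complementation exchanges the two kinds. *)
Lemma lbr_conv_diag (c : L) e f M : homog e c -> homog_family d f ->
  lbr c (conv d f f M) = 2%:R *: \sum_(Z : {set 'I_k} | Z \subset M)
    (kap d Z (M :\: Z) * signz (udeg d Z)) *: lbr (lbr c (f Z)) (f (M :\: Z)).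
Proof.
move=> ce hf; rewrite /conv linear_sum scaler_nat mulr2n.
under eq_bigr => Z _ do rewrite linearZ_LR /= (lbr_jacobi _ _ _ _ _ ce (hf Z)) scalerDr.
rewrite big_split /=; congr (_ + _).
have E (F : {set 'I_k} -> L) : \sum_(X : {set 'I_k} | X \subset M) F X =
    \sum_(X : {set 'I_k} | (X \subset M) && predT X) F X.
  by apply: eq_bigl => X; rewrite andbT.
rewrite E big_subsetC -E; apply: eq_bigr => Z ZM; rewrite setDSK //.
have hcZ := lbr_homog _ _ _ _ ce (hf Z).
rewrite (lbr_anti _ _ _ _ (hf (M :\: Z)) hcZ) scalerA scalerN scalerA -scaleNr.
congr (_ *: _); have := kapC d (disjointD M Z).
move: (kap d Z _) (kapK d Z (M :\: Z)) => u uK.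
move=> /(congr1 ( *%R u)); rewrite mulrA uK mul1r => ->.
move: (udeg d Z) (udeg d (M :\: Z)) => p q.
rewrite !mulrDl !mulrDr mulr1 mul1r !signzM signz1 (mulrC p q) (mulrC e q).
move: (signz (q * p)) (signzK (q * p)) (signz q) (signzK q) => w wK v vK.
move: (signz (q * e)) (signzK (q * e)) => z zK.
transitivity (u * signz p * (w * w) * (v * v) * (z * z)); first by ring.
by rewrite wK vK zK !mulr1.
Qed.

End ConvolutionMore.

Section Gauge.
Variables (k : nat) (d : 'I_k -> int) (L : dgLieType).
Implicit Types (X Y Z I J M : {set 'I_k}) (a : {set 'I_k} -> L).

Definition curvature a J : L := ldiff (a J) - 2%:R^-1 *: conv d a a J.

(** The components of -d(c e_I) + [c e_I, a]. *)
Definition gauge_shift I (c : L) a J : L :=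
  (if J == I then - ldiff c else 0) +
  (if I \subset J then
     (signz (udeg d I + 1) * kap d I (J :\: I)) *: lbr c (a (J :\: I)) else 0).

Variables (I : {set 'I_k}) (c : L) (a : {set 'I_k} -> L).
Hypotheses (I0 : I != set0) (hc : homog (udeg d I + 1) c).
Hypotheses (ha : homog_family d a) (a0 : a set0 = 0).

Lemma homog_gauge_shift : homog_family d (gauge_shift I c a).
Proof.
move=> J; apply: homogD.
  case: eqP => [->|_]; last exact: homog0.
  rewrite -scaleN1r; apply: homogZ; rewrite -[udeg d I](addrK 1).
  exact: ldiff_homog.
case: ifP => [IJ|_]; last exact: homog0.
apply: homogZ; rewrite -{1}(setUDK IJ) udegU ?disjointD // addrAC.
exact: lbr_homog.
Qed.

Lemma gauge_shift_notsub J : ~~ (I \subset J) -> gauge_shift I c a J = 0.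
Proof.
move=> nIJ; rewrite /gauge_shift (negPf nIJ) addr0.
by case: eqP nIJ => // ->; rewrite subxx.
Qed.

Lemma gauge_shift_self : gauge_shift I c a I = - ldiff c.
Proof. by rewrite /gauge_shift eqxx subxx setDv a0 !linear0 addr0. Qed.

Lemma conv_gauge_shift J : I \subset J ->
  conv d (gauge_shift I c a) a J =
  kap d I (J :\: I) *: (- signz (udeg d I) *: lbr (ldiff c) (a (J :\: I)) +
    2%:R^-1 *: lbr c (conv d a a (J :\: I))).
Proof.
move=> IJ; rewrite (lbr_conv_diag _ hc ha) scalerA mulVf ?pnatr_eq0 // scale1r.
rewrite /conv (bigID (fun X => I \subset X)) /= [X in _ + X]big1 ?addr0; last first.
  by move=> X /andP[_ nIX]; rewrite gauge_shift_notsub // lbr0l scaler0.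
rewrite big_superset //; set M := J :\: I.
have dI Z : Z \subset M -> [disjoint I & Z].
  by move=> ZM; rewrite disjoint_sym (disjointWl ZM) // disjoint_sym disjointD.
rewrite scalerDr scaler_sumr.
transitivity (\sum_(Z : {set 'I_k} | Z \subset M)
   ((if Z == set0 then kap d I M *: (- signz (udeg d I) *: lbr (ldiff c) (a M)) else 0)
   + kap d I M *: ((kap d Z (M :\: Z) * signz (udeg d Z)) *:
                    lbr (lbr c (a Z)) (a (M :\: Z))))).
  apply: eq_bigr => Z ZM; have dIZ := dI Z ZM.
  have -> : J :\: (I :|: Z) = M :\: Z by rewrite setDDl.
  have E : (I :|: Z) :\: I = Z.
    by rewrite setDUl setDv set0U; apply/setDidPl; rewrite disjoint_sym.
  rewrite /gauge_shift E subsetUl lbrDl scalerDr; congr (_ + _).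
    have -> : (I :|: Z == I) = (Z == set0).
      apply/eqP/eqP => [EI|->]; last by rewrite setU0.
      by rewrite -E EI setDv.
    case: eqP => [->|_]; last by rewrite lbr0l scaler0.
    by rewrite setU0 setD0 lbrNl scalerN scalerA mulrN scaleNr.
  rewrite lbrZl !scalerA; congr (_ *: _).
  have -> : kap d I M = kap d I Z * kap d I (M :\: Z).
    by rewrite -{1}(setUDK ZM) kapUr ?disjointD.
  rewrite kapUl // udegU //.
  move: (udeg d I) (udeg d Z) => p q.
  rewrite !signzM; move: (signzK p) (signzK 1); move: (signz p) (signz 1) => v t vK tK.
  move: (kap d I Z) (kap d I (M :\: Z)) (kap d Z (M :\: Z)) (signz q) => u w z s.
  transitivity (u * w * (z * s) * (v * v) * (t * t)); first by ring.
  by rewrite vK tK !mulr1.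
rewrite big_split /=; congr (_ + _); rewrite (bigD1 set0) ?sub0set //= eqxx.
by rewrite big1 ?addr0 // => Z /andP[_ /negPf ->].
Qed.

(** The terms with dc agree on both sides.  The remaining ones are [c, d a_M] and
    [c, 1/2 (a, a)_M] for M = J - I, a proper subset of J on which a is flat. *)
Lemma ldiff_gauge_shift J : (forall M, M \proper J -> curvature a M = 0) ->
  ldiff (gauge_shift I c a J) = conv d (gauge_shift I c a) a J.
Proof.
move=> flat; have [IJ|nIJ] := boolP (I \subset J); last first.
  rewrite gauge_shift_notsub // linear0 /conv big1 // => X XJ.
  rewrite gauge_shift_notsub ?lbr0l ?scaler0 //.
  by apply: contra nIJ => /subset_trans; apply.
rewrite conv_gauge_shift //; set M := J :\: I.
have /flat/eqP : M \proper J.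
  rewrite properEneq subsetDl andbT; apply: contraNneq I0 => E.
  by rewrite -(setDSK IJ) -/M E setDv.
rewrite /curvature subr_eq0 => /eqP flatM.
rewrite -(linearZ_LR (lbr c)) -flatM /gauge_shift IJ -/M linearD /=.
have -> : ldiff (if J == I then - ldiff c else 0) = 0.
  by case: eqP => _; rewrite ?linearN ?linear0 //= ldiff_ldiff oppr0.
rewrite add0r linearZ_LR /= (ldiff_lbr _ _ _ hc) mulrC -scalerA; congr (_ *: _).
rewrite scalerDr scalerA signzK scale1r; congr (_ *: _ + _).
by rewrite signzM signz1 mulrN1.
Qed.

(** The part of the convolution quadratic in the shift vanishes, and the two linear
    ones are equal. *)
Lemma curvature_gauge J : (forall M, M \proper J -> curvature a M = 0) ->
  curvature (fun X => a X + gauge_shift I c a X) J = curvature a J.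
Proof.
move=> /ldiff_gauge_shift.
have := conv_disjoint0 d I0 gauge_shift_notsub gauge_shift_notsub J.
move: (gauge_shift I c a) homog_gauge_shift => g hg gg0 dg.
rewrite /curvature convDl !convDr gg0 addr0 (convC _ ha hg) linearD /= dg.
move: (conv d g a J) => s.
rewrite -[_ + s + s]addrA scalerDr opprD addrACA -mulr2n -scaler_nat scalerA.
by rewrite mulVf ?pnatr_eq0 // scale1r subrr addr0.
Qed.

End Gauge.

(** * Normalisation of a Maurer-Cartan family *)

Section Normalise.
Variables (k : nat) (d : 'I_k -> int) (L : dgLieType) (r : homotopy_retract L).
Implicit Types (X Y Z I J M : {set 'I_k}) (a : {set 'I_k} -> L).

Definition normal_at a I : Prop := a I = hr_i r (hr_q r (a I)) + hr_K r (ldiff (a I)).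

(** One gauge transformation along c = K a_I normalises a at I, by the homotopy
    identity, and affects only the sets that contain I.  So the set D of subsets
    already treated is kept closed under inclusion, and I is chosen of minimal size
    outside D. *)
Lemma normalise a : homog_family d a -> a set0 = 0 ->
  (forall J, J \proper [set: 'I_k] -> curvature d a J = 0) ->
  exists a' : {set 'I_k} -> L, [/\ homog_family d a', a' set0 = 0,
    curvature d a' =1 curvature d a,
    forall i, hr_q r (a' [set i]) = hr_q r (a [set i])
    & forall J, J \proper [set: 'I_k] -> normal_at a' J].
Proof.
move=> ha a0 flat.
suff /(_ #|{set 'I_k}|) H n : exists (a' : {set 'I_k} -> L) (D : {set {set 'I_k}}),
    [/\ homog_family d a', a' set0 = 0, curvature d a' =1 curvature d a,
      forall i, hr_q r (a' [set i]) = hr_q r (a [set i]) &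
    [/\ forall I J, I \subset J -> J \in D -> I \in D,
        forall J, J \in D -> J \proper [set: 'I_k] -> normal_at a' J
      & (D == [set: {set 'I_k}]) || (n <= #|D|)%N]].
  have [a' [D [ha' a'0 ca' qa' [_ nD bD]]]] := H.
  exists a'; split => // J; apply: nD.
  suff /eqP -> : D == [set: {set 'I_k}] by rewrite inE.
  by case/orP: bD => // bD; rewrite eqEcard subsetT cardsT.
elim: n => [|n [a' [D [ha' a'0 ca' qa' [down nD bD]]]]].
  by exists a, set0; split => //; split => [I J|J|]; rewrite ?inE ?orbT.
have [/eqP DT|DnT] := boolP (D == [set: {set 'I_k}]).
  by exists a', D; split => //; split => //; rewrite DT eqxx.
rewrite (negPf DnT) /= in bD.
have /set0Pn[I1] : ~: D != set0 by apply: contraNneq DnT => E; rewrite -(setCK D) E setC0.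
rewrite inE => I1D.
case: (@arg_minnP _ I1 (fun I => I \notin D) (fun I => #|I|) I1D) => I ID Imin.
have ltI J : J \proper I -> J \in D.
  move=> /proper_card JI; apply: contraLR JI; rewrite -leqNgt; exact: Imin.
have downI (A B : {set 'I_k}) : A \subset B -> B \in I |: D -> A \in I |: D.
  move=> AB; rewrite !inE => /orP[/eqP BI|BD]; last by rewrite (down _ _ AB BD) orbT.
  have [//|AI] := eqVneq A I; rewrite ltI ?orbT // properEneq AI -BI //.
have cardI : (n.+1 <= #|I |: D|)%N by rewrite cardsU1 ID.
have flat' J : J \proper [set: 'I_k] -> curvature d a' J = 0.
  by move=> JT; rewrite ca' flat.
have [I0|I0] := eqVneq I set0.
  (* At the empty set the family is zero, hence already normal. *)
  exists a', (I |: D); split => //; split => // [J|]; last by rewrite cardI orbT.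
  rewrite !inE => /orP[/eqP -> _|]; last exact: nD.
  by rewrite /normal_at I0 a'0 !linear0 addr0.
pose c := hr_K r (a' I).
have hc : homog (udeg d I + 1) c by apply/hr_K_homog/ha'.
pose b X := a' X + gauge_shift d I c a' X.
have bD' J : J \in D -> b J = a' J.
  move=> JD; rewrite /b gauge_shift_notsub ?addr0 //.
  by apply: contra ID => IJ; apply: down IJ JD.
have bI : b I = a' I - ldiff c by rewrite /b gauge_shift_self.
exists b, (I |: D); split.
- by move=> X; apply: homogD (ha' X) _; apply: homog_gauge_shift.
- rewrite /b a'0 add0r gauge_shift_notsub // subset0 //.
- move=> J; rewrite curvature_gauge // => M MJ; apply: flat'.
  by apply: proper_sub_trans MJ (subsetT J).
- (* At a singleton the shift is zero or the boundary -dc. *)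
  move=> i; rewrite -qa' /b linearD /=.
  have [Ii|nIi] := boolP (I \subset [set i]); last by rewrite gauge_shift_notsub ?linear0 ?addr0.
  have -> : [set i] = I by apply/eqP; rewrite eq_sym; move: Ii; rewrite subset1 (negPf I0) orbF.
  by rewrite gauge_shift_self // linearN /= hr_q_chain oppr0 addr0.
split => // [J|]; last by rewrite cardI orbT.
rewrite !inE => /orP[/eqP -> _|JD JT]; last by rewrite /normal_at bD' //; apply: nD.
rewrite /normal_at bI linearB /= hr_q_chain subr0 linearB /= ldiff_ldiff subr0.
have /eqP := hr_homotopy r (a' I); rewrite -/c subr_eq => /eqP E.
by rewrite {1}E addrC addrA addKr addrC.
Qed.

End Normalise.

(** * Trees evaluated on families *)

(** One factor 1/2 for each vertex, from 1/2 [a, a]. *)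
Definition tree_weight (T : btree) : rat := 2%:R ^- (leaves T).-1.

Lemma tree_weight_node A B :
  tree_weight (Node A B) = 2%:R^-1 * (tree_weight A * tree_weight B).
Proof.
rewrite /tree_weight /= -!exprVn -exprD -exprS; congr (_ ^+ _).
by have := leaves_gt0 A; have := leaves_gt0 B; lia.
Qed.

Section BranchLinear.
Variables (L : dgLieType) (r : homotopy_retract L) (T : btree).
Fact branch_is_linear : linear (branch r T).
Proof. by case: T => [|A B] c x y //=; apply: linearP. Qed.
HB.instance Definition _ :=
  GRing.isLinear.Build rat L L *:%R (branch r T) branch_is_linear.
End BranchLinear.

Section TreeFamilies.
Variables (k : nat) (d : 'I_k -> int) (L : dgLieType) (r : homotopy_retract L).
Implicit Types (X Y Z I J M : {set 'I_k}) (a : {set 'I_k} -> L) (T A B S : btree).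
Implicit Types (h : {set 'I_k} -> homology L).

(** The component at I of the tree map applied to h in all its leaves, computed in
    L (x) E. *)
Fixpoint tree_conv h T : {set 'I_k} -> L :=
  if T is Node A B then
    conv d (fun X => branch r A (tree_conv h A X)) (fun X => branch r B (tree_conv h B X))
  else fun I => hr_i r (h I).

Lemma homog_branch_tree_conv h T : (forall X, homog (udeg d X) (h X)) ->
  homog_family d (fun X => branch r T (tree_conv h T X)).
Proof.
move=> hh; elim: T => [|A IHA B IHB] X /=; first exact/hr_i_homog.
rewrite -[udeg d X](subrK 1); apply: hr_K_homog.
exact: homog_conv.
Qed.

Lemma tree_conv_set0 h T : h set0 = 0 -> tree_conv h T set0 = 0.
Proof.
move=> h0; elim: T => [|A IHA B IHB] /=; first by rewrite h0 linear0.
by rewrite conv_set0 // IHA linear0.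
Qed.

(** Exchanging the two branches at a vertex is harmless because the convolution is
    commutative on families of the right degrees. *)
Lemma tree_conv_iso h T T' : (forall X, homog (udeg d X) (h X)) ->
  tree_iso T T' -> tree_conv h T =1 tree_conv h T'.
Proof.
move=> hh; elim: T T' => [|A IHA B IHB] [|A' B'] //= iT I.
have br C C' : tree_iso C C' -> tree_conv h C =1 tree_conv h C' ->
    forall X, branch r C (tree_conv h C X) = branch r C' (tree_conv h C' X).
  by case: C C' => [|C1 C2] [|C1' C2'] //= _ E X; rewrite E.
have hb := homog_branch_tree_conv _ hh.
case/orP: iT => /andP[iA iB]; last rewrite convC //.
  apply: eq_bigr => X _.
  by rewrite (br _ _ iA (IHA _ iA)) (br _ _ iB (IHB _ iB)).
apply: eq_bigr => X _.
by rewrite (br _ _ iA (IHA _ iA)) (br _ _ iB (IHB _ iB)).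
Qed.

(** Bilinearity: a pair of trees is a tree with one more vertex. *)
Lemma half_conv_trees h a (ts : seq btree) I : h set0 = 0 -> a set0 = 0 ->
  (forall X, X \proper I ->
     a X = \sum_(T <- ts) tree_weight T *: branch r T (tree_conv h T X)) ->
  2%:R^-1 *: conv d a a I =
  \sum_(S <- [seq Node A B | A <- ts, B <- ts]) tree_weight S *: tree_conv h S I.
Proof.
move=> h0 a0 aE.
have z0 : \sum_(T <- ts) tree_weight T *: branch r T (tree_conv h T set0) = 0.
  by rewrite big1 // => T _; rewrite tree_conv_set0 // linear0 scaler0.
rewrite (eq_conv d a0 z0 a0 z0 aE aE).
rewrite (conv_suml d ts tree_weight (fun T X => branch r T (tree_conv h T X))).
rewrite big_allpairs_dep /= scaler_sumr; apply: eq_bigr => A _.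
rewrite (conv_sumr d ts tree_weight _ (fun T X => branch r T (tree_conv h T X))).
rewrite !scaler_sumr; apply: eq_bigr => B _.
by rewrite !scalerA tree_weight_node mulrA.
Qed.

(** Unfold a = i h + K (1/2 (a, a)).  The blocks of a splitting are strictly smaller
    than J, since the empty block contributes nothing, so a set of m + 1 elements
    needs trees of depth at most m only. *)
Lemma tree_expansion h a I0 : h set0 = 0 -> a set0 = 0 ->
  (forall J, J \proper I0 -> a J = hr_i r (h J) + hr_K r (2%:R^-1 *: conv d a a J)) ->
  forall m J, J \proper I0 -> (#|J| <= m.+1)%N ->
    a J = \sum_(T <- trees_upto m) tree_weight T *: branch r T (tree_conv h T J).
Proof.
move=> h0 a0 aE; elim=> [|m IHm] J JI0 Jm; rewrite {1}aE //=.
  rewrite big_seq1 /tree_weight /= expr0 invr1 scale1r.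
  rewrite (@half_conv_trees h a [::]) ?big_nil ?linear0 ?addr0 // => X.
  rewrite big_nil => /proper_card XJ.
  have := leq_trans XJ Jm; rewrite ltnS leqn0 cards_eq0 => /eqP ->.
  exact: a0.
rewrite big_cons /tree_weight /= expr0 invr1 scale1r; congr (_ + _).
rewrite (@half_conv_trees h a (trees_upto m)) // => [|X XJ].
  rewrite linear_sum !big_allpairs_dep; apply: eq_bigr => A _.
  by apply: eq_bigr => B _; rewrite linearZ_LR.
apply: IHm; first exact: proper_trans XJ JI0.
by rewrite -ltnS (leq_trans (proper_card XJ) Jm).
Qed.

End TreeFamilies.

(** * Suspended tree maps *)

Section SuspendedTree.
Variables (L : dgLieType) (r : homotopy_retract L).
Implicit Types (w : seq (int * homology L)) (T A B : btree).

(** The tree map for the shifted bracket: the sign at a vertex is that of the shifted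
    bracket, determined by the total degree sum (|v| + 1) - 1 of the left branch, and
    the maps themselves are of degree 0 and produce no further signs. *)
Fixpoint stree T w : L :=
  if T is Node A B then
    signz (\sum_(v <- take (leaves A) w) (v.1 + 1) - 1) *:
      lbr (branch r A (stree A (take (leaves A) w)))
          (branch r B (stree B (drop (leaves A) w)))
  else hr_i r (head (0, 0) w).2.

(** The sign [theta] of the list of degrees, in a form suited to recursion on trees. *)
Fixpoint seq_theta w : rat :=
  if w is v :: w' then signz (v.1 * (size w')%:Z) * seq_theta w' else 1.

Lemma seq_theta_cat w w' : seq_theta (w ++ w') =
  seq_theta w * seq_theta w' * signz ((size w')%:Z * \sum_(v <- w) v.1).
Proof.
elim: w => [|v w IHw] /=; first by rewrite big_nil mulr0 signz0 mul1r mulr1.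
rewrite IHw big_cons size_cat PoszD !mulrDr !signzM (mulrC v.1 (size w')).
by ring.
Qed.

Lemma KcountE T : Kcount T = (leaves T).-1.
Proof.
elim: T => //= A -> B ->.
by have := leaves_gt0 A; have := leaves_gt0 B; lia.
Qed.

Lemma sum_degS w :
  \sum_(v <- w) (v.1 + 1) = \sum_(v <- w) v.1 + (size w)%:Z.
Proof.
elim: w => [|v w IHw]; rewrite ?big_nil // !big_cons IHw /= -addn1 PoszD.
by ring.
Qed.

(** At a vertex with leaves p + q the sign of the labels and of the q - 1 maps K in
    the right branch differs from that of the shifted bracket by (-1)^(q S), with S
    the degree of the left inputs: each left input passes q suspensions. *)
Lemma tree_map_stree T w : size w = leaves T ->
  tree_map r T w = seq_theta w *: stree T w.
Proof.
elim: T w => [|A IHA B IHB] w /=.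
  by case: w => [|v [|v' w]] //= _; rewrite mulr0 signz0 mulr1 scale1r.
move=> sw; have sA : size (take (leaves A) w) = leaves A.
  by rewrite size_takel // sw leq_addr.
have sB : size (drop (leaves A) w) = leaves B by rewrite size_drop sw addKn.
have -> : seq_theta w = seq_theta (take (leaves A) w ++ drop (leaves A) w).
  by rewrite cat_take_drop.
rewrite IHA // IHB // seq_theta_cat sB.
rewrite !(linearZ_LR (branch _ _)) lbrZl (linearZ_LR (lbr _)) !scalerA; congr (_ *: _).
rewrite sum_degS sA KcountE; set S := \sum_(v <- _) v.1.
rewrite !signzM; case: (leaves A) (leaves B) (leaves_gt0 A) (leaves_gt0 B) => // a [] //= b _ _.
rewrite -[a.+1]addn1 -[b.+1]addn1 !PoszD !mulrDl mul1r !signzM signzN.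
rewrite -[(-1) ^+ a]/(signz a).
rewrite -[Posz 1]/(1%R : int); move: (signzK S) (signzK 1); move: (signz S) (signz 1) => s o sK oK.
move: (signz a) (signz (b%:Z * S)) (seq_theta _) (seq_theta _) => u v w1 w2.
transitivity (u * v * w1 * w2 * (s * s) * (o * o)); last by ring.
by rewrite sK oK; ring.
Qed.

End SuspendedTree.

(** * Sums over ordered partitions *)

Section OrderedPartitions.
Variables (k : nat) (d : 'I_k -> int).
Implicit Types (X Y Z I J M : {set 'I_k}).

(** Both sides run over the splittings of I into three blocks X, Y, I - X - Y. *)
Lemma sum_subsets_assoc (V : nmodType) I (F : {set 'I_k} -> {set 'I_k} -> {set 'I_k} -> V) :
  \sum_(X : {set 'I_k} | X \subset I) \sum_(Y : {set 'I_k} | Y \subset I :\: X)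
     F X Y ((I :\: X) :\: Y) =
  \sum_(Z : {set 'I_k} | Z \subset I) \sum_(X : {set 'I_k} | X \subset Z)
     F X (Z :\: X) (I :\: Z).
Proof.
rewrite !pair_big_dep /=.
rewrite (reindex_onto (fun u : {set 'I_k} * {set 'I_k} => (u.2, u.1 :\: u.2))
  (fun u : {set 'I_k} * {set 'I_k} => (u.1 :|: u.2, u.1))) /=; last first.
  move=> [X Y] /= /andP[XI]; rewrite subsetD => /andP[YI dYX].
  by rewrite setDUl setDv set0U; congr (_, _); apply/setDidPl.
have E (Z X : {set 'I_k}) : X :|: (Z :\: X) = X :|: Z.
  by apply/setP => i; rewrite !inE; case: (i \in X).
apply: eq_big => [[Z X]|[Z X]] /=.
  apply/idP/idP => [/andP[/andP[XI ZI] /eqP[]]|/andP[ZI XZ]].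
    rewrite E => <-; rewrite subsetUl andbT subUset XI /=.
    by apply/subsetP => i iZ; have [iX|iX] := boolP (i \in X);
      [exact: (subsetP XI) | have := subsetP ZI i; rewrite !inE iX iZ => /(_ isT)].
  by rewrite E (setUidPr XZ) eqxx (subset_trans XZ ZI) setSD.
rewrite E => /andP[_ /eqP[E2]]; rewrite setDDl E.
by rewrite E2.
Qed.

(** The sum over the ordered partitions of I into j blocks, possibly empty, with the
    Koszul sign of regrouping; the recursion splits off the first block. *)
Fixpoint psum (V : lmodType rat) j I (F : seq {set 'I_k} -> V) : V :=
  if j is j'.+1 then
    \sum_(X : {set 'I_k} | X \subset I)
      kap d X (I :\: X) *: psum j' (I :\: X) (fun t => F (X :: t))
  else if I == set0 then F [::] else 0.

Section PsumTheory.
Variable V : lmodType rat.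
Implicit Types F G : seq {set 'I_k} -> V.

Lemma psum_lin (W : lmodType rat) (phi : {linear V -> W}) j I F :
  phi (psum j I F) = psum j I (fun t => phi (F t)).
Proof.
elim: j I F => [|j IHj] I F /=; first by case: eqP => //; rewrite linear0.
by rewrite linear_sum; apply: eq_bigr => X _; rewrite linearZ_LR IHj.
Qed.

Lemma eq_psum j I F G :
  (forall t, size t = j -> \sum_(X <- t) (udeg d X + 1) = udeg d I + 1 -> F t = G t) ->
  psum j I F = psum j I G.
Proof.
elim: j I F G => [|j IHj] I F G FG /=.
  by case: eqP => // I0; apply: FG; rewrite // big_nil I0 udeg1_sum big_set0.
apply: eq_bigr => X XI; congr (_ *: _); apply: IHj => t tj tI.
apply: FG; rewrite /= ?tj // big_cons tI.
by rewrite -{2}(setUDK XI) udegU ?disjointD //; ring.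
Qed.

Lemma psum_cat p q I F : psum (p + q) I F =
  \sum_(X : {set 'I_k} | X \subset I) kap d X (I :\: X) *:
    psum p X (fun s => psum q (I :\: X) (fun t => F (s ++ t))).
Proof.
elim: p I F => [|p IHp] I F /=.
  rewrite (bigD1 set0) ?sub0set //= eqxx kap0X scale1r setD0 big1 ?addr0 //.
  by move=> X /andP[_ /negPf ->]; rewrite scaler0.
under eq_bigr => X _ do rewrite IHp scaler_sumr.
pose H X Y Z := kap d X (Y :|: Z) *: (kap d Y Z *:
  psum p Y (fun s => psum q Z (fun t => F (X :: (s ++ t))))).
transitivity (\sum_(X : {set 'I_k} | X \subset I) \sum_(Y : {set 'I_k} | Y \subset I :\: X)
     H X Y ((I :\: X) :\: Y)).
  by apply: eq_bigr => X XI; apply: eq_bigr => Y YI; rewrite /H setUDK.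
rewrite sum_subsets_assoc; apply: eq_bigr => Z ZI.
rewrite scaler_sumr; apply: eq_bigr => X XZ; rewrite /H !scalerA.
congr (_ *: _).
have dZ : [disjoint Z & I :\: Z] by rewrite disjointD.
rewrite kapUr; last by rewrite (disjointWl _ dZ) // subsetDl.
have -> : kap d Z (I :\: Z) = kap d X (I :\: Z) * kap d (Z :\: X) (I :\: Z).
  by rewrite -kapUl ?disjointD // setUDK.
by ring.
Qed.

End PsumTheory.

Lemma psum_bilin (L : gradedLieType) p q X Y (F G : seq {set 'I_k} -> L) :
  lbr (psum p X F) (psum q Y G) =
  psum p X (fun s => psum q Y (fun t => lbr (F s) (G t))).
Proof.
rewrite -[LHS]/(lbrl _ _) psum_lin; apply: eq_psum => s _ _.
exact: (psum_lin (lbr (F s))).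
Qed.

Lemma tree_conv_psum (L : dgLieType) (r : homotopy_retract L)
    (h : {set 'I_k} -> homology L) T I :
  tree_conv d r h T I =
  psum (leaves T) I (fun t => stree r T [seq (udeg d X, h X) | X <- t]).
Proof.
elim: T I => [|A IHA B IHB] I /=.
  rewrite (bigD1 I) //= setDv kapX0 scale1r eqxx big1 ?addr0 // => X /andP[XI XnI].
  by rewrite setD_eq0 eqEsubset XI andTb in XnI *; rewrite (negPf XnI) scaler0.
rewrite psum_cat; apply: eq_bigr => X XI.
rewrite IHA IHB (psum_lin (branch r A)) (psum_lin (branch r B)) psum_bilin -scalerA; congr (_ *: _).
rewrite (psum_lin ( *:%R (signz (udeg d X)))); apply: eq_psum => s ss sX.
rewrite (psum_lin ( *:%R (signz (udeg d X)))); apply: eq_psum => t st tY.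
have sm : size [seq (udeg d Z, h Z) | Z <- s] = leaves A by rewrite size_map.
by rewrite map_cat take_cat drop_cat sm ltnn subnn take0 drop0 cats0 big_map /= sX addrK.
Qed.

End OrderedPartitions.

Section PartitionFunctions.
Variables (k : nat) (d : 'I_k -> int).
Implicit Types (X Y Z I J M : {set 'I_k}).

(** Counting multiplicities says at once that the blocks are disjoint and that they
    cover I, in a form that is additive in the blocks and invariant under their
    permutations. *)
Definition part s I (t : 'I_s -> {set 'I_k}) : bool :=
  [forall x, (\sum_(a < s) (x \in t a) == (x \in I) :> nat)%N].

Definition part_sign s (t : 'I_s -> {set 'I_k}) : rat :=
  \prod_(a < s) \prod_(b < s | (a < b)%N) kap d (t a) (t b).

Lemma part_big (R : Type) (idx : R) (op : Monoid.com_law idx) s I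
    (t : 'I_s -> {set 'I_k}) (g : 'I_k -> R) : part I t ->
  \big[op/idx]_(y in I) g y = \big[op/idx]_(a < s) \big[op/idx]_(y in t a) g y.
Proof.
move=> /forallP pt; rewrite (exchange_big_dep predT) //= [LHS]big_mkcond.
apply: eq_bigr => y _; have /eqP := pt y.
have -> : (\sum_(a < s) (y \in t a) = #|[pred a : 'I_s | y \in t a]|)%N.
  by rewrite -sum1_card [RHS]big_mkcond; apply: eq_bigr => a _ /=; rewrite inE; case: ifP.
move=> E; transitivity (iter #|[pred a : 'I_s | y \in t a]| (op (g y)) idx).
  by rewrite E; case: (y \in I) => //=; rewrite Monoid.mulm1.
by rewrite -big_const; apply: eq_bigl => a.
Qed.

Lemma part_disjoint s I (t : 'I_s -> {set 'I_k}) a b : part I t ->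
  a != b -> [disjoint t a & t b].
Proof.
move=> /forallP pt ab; rewrite -setI_eq0; apply/eqP/setP => x; rewrite !inE.
apply/negbTE/negP => /andP[xa xb]; have /eqP := pt x.
rewrite (bigD1 a) //= (bigD1 b) 1?eq_sym //= xa xb.
by case: (x \in I).
Qed.

Lemma part_perm s I (t : 'I_s -> {set 'I_k}) (sigma : 'S_s) :
  part I (fun a => t (sigma a)) = part I t.
Proof.
apply: eq_forallb => x; congr (_ == _).
by rewrite [RHS](reindex_inj (@perm_inj _ sigma)).
Qed.

(** Exchanging two disjoint blocks costs the Koszul sign of their degrees. *)
Lemma part_sign_perm s I (t : 'I_s -> {set 'I_k}) (sigma : 'S_s) : part I t ->
  part_sign (fun a => t (sigma a)) =
  part_sign t * koszul (fun a => udeg d (t a) + 1) sigma.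
Proof.
move=> pt; rewrite /part_sign /koszul.
rewrite -[X in _ = X * _](prod_inversions (fun a b => kap d (t a) (t b)) sigma).
rewrite -big_split /=; apply: eq_bigr => a _.
rewrite [X in _ = _ * X]big_mkcondr /= -big_split /=; apply: eq_bigr => b ab.
have [sab|sab|/val_inj/perm_inj E] := ltngtP (sigma b) (sigma a).
- rewrite -kapC; last first.
    by apply: part_disjoint pt _; rewrite -val_eqE /= gtn_eqF.
  by rewrite mulrCA kapK mulr1.
- by rewrite mulr1.
by rewrite E ltnn in ab.
Qed.

Definition consf s X (t : {ffun 'I_s -> {set 'I_k}}) : {ffun 'I_s.+1 -> {set 'I_k}} :=
  [ffun a => if unlift ord0 a is Some b then t b else X].

Lemma consf0 s X (t : {ffun 'I_s -> {set 'I_k}}) : consf X t ord0 = X.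
Proof. by rewrite ffunE unlift_none. Qed.

Lemma consfS s X (t : {ffun 'I_s -> {set 'I_k}}) a : consf X t (lift ord0 a) = t a.
Proof. by rewrite ffunE liftK. Qed.

Lemma part_consf s I X (t : {ffun 'I_s -> {set 'I_k}}) :
  part I (consf X t) = (X \subset I) && part (I :\: X) t.
Proof.
have E x : (\sum_(a < s.+1) (x \in consf X t a) = (x \in X) + \sum_(a < s) (x \in t a))%N.
  by rewrite big_ord_recl consf0; under eq_bigr => a _ do rewrite consfS.
apply/forallP/andP => [pt|[XI /forallP pt] x].
  have XI : X \subset I.
    apply/subsetP => x xX; have := pt x; rewrite E xX.
    by case: (x \in I) => //; rewrite add1n.
  split=> //; apply/forallP => x; have := pt x; rewrite E !inE.
  by have := subsetP XI x; case: (x \in X) => [/(_ isT) ->|_].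
rewrite E; have := pt x; rewrite !inE.
by have := subsetP XI x; case: (x \in X) => [/(_ isT) -> /eqP ->|_].
Qed.

Lemma part_sign_consf s I X (t : {ffun 'I_s -> {set 'I_k}}) : part I t ->
  part_sign (consf X t) = kap d X I * part_sign t.
Proof.
move=> pt; rewrite /part_sign big_ord_recl; congr (_ * _).
  rewrite big_mkcond big_ord_recl /= mul1r consf0.
  under eq_bigr => a _ do rewrite consfS.
  under [LHS]eq_bigr => a _ do rewrite kapE.
  by rewrite kapE exchange_big; apply: eq_bigr => x _ /=; rewrite (part_big _ _ pt).
apply: eq_bigr => a _; rewrite big_mkcond big_ord_recl /= mul1r [RHS]big_mkcond.
by apply: eq_bigr => b _; rewrite !consfS.
Qed.

Lemma psum_partE (V : lmodType rat) j I (F : seq {set 'I_k} -> V) :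
  psum d j I F = \sum_(t : {ffun 'I_j -> {set 'I_k}} | part I t)
    part_sign t *: F [seq t a | a <- enum 'I_j].
Proof.
elim: j I F => [|j IHj] I F /=.
  have e0 : enum 'I_0 = [::] by apply: size0nil; rewrite size_enum_ord.
  have E (t : {ffun 'I_0 -> {set 'I_k}}) : part I t = (I == set0).
    apply/forallP/eqP => [pt|-> x]; last by rewrite big_ord0 inE.
    apply/setP => x; have := pt x; rewrite big_ord0 inE.
    by case: (x \in I).
  case: eqP => I0; last by rewrite big_pred0 // => t; rewrite E; apply/eqP.
  rewrite (big_pred1 [ffun=> set0]) => [|t].
    by rewrite e0 /part_sign big_ord0 scale1r.
  by rewrite E I0 eqxx; apply/esym/eqP/ffunP => -[].
under eq_bigr => X _ do rewrite IHj scaler_sumr.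
rewrite pair_big_dep /=.
rewrite [RHS](reindex_onto (fun u : {set 'I_k} * {ffun 'I_j -> {set 'I_k}} => consf u.1 u.2)
   (fun t => (t ord0, [ffun a => t (lift ord0 a)]))) /=; last first.
  move=> t _; apply/ffunP => a; case: (unliftP ord0 a) => [b|] ->.
    by rewrite consfS ffunE.
  by rewrite consf0.
apply: eq_big => [[X t]|[X t] /andP[XI pt]] /=.
  rewrite part_consf consf0 -[LHS]andbT; congr (_ && _).
  by apply/esym/eqP; congr (_, _); apply/ffunP => a; rewrite ffunE consfS.
rewrite (part_sign_consf X pt) scalerA enum_ordSl /= consf0 -map_comp.
congr (_ *: F (_ :: _)); apply: eq_map => a /=.
by rewrite consfS.
Qed.

(** Over the rationals the orbits of S_j on ordered partitions need no enumeration: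
    one averages over all reorderings. *)
Lemma psum_average (V : lmodType rat) j I (F : seq {set 'I_k} -> V) :
  psum d j I F = \sum_(t : {ffun 'I_j -> {set 'I_k}} | part I t)
    (part_sign t / j`!%:R) *: \sum_(sigma : 'S_j)
       koszul (fun a => udeg d (t a) + 1) sigma *: F [seq t (sigma a) | a <- enum 'I_j].
Proof.
have nz : (j`!%:R : rat) != 0 by rewrite pnatr_eq0 -lt0n fact_gt0.
rewrite psum_partE; set S := \sum_(t | _) _.
have E (sigma : 'S_j) : S = \sum_(t : {ffun 'I_j -> {set 'I_k}} | part I t)
    (part_sign t * koszul (fun a => udeg d (t a) + 1) sigma) *:
       F [seq t (sigma a) | a <- enum 'I_j].
  rewrite {}/S (reindex_onto (fun t : {ffun 'I_j -> {set 'I_k}} => [ffun a => t (sigma a)])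
    (fun t : {ffun 'I_j -> {set 'I_k}} => [ffun a => t ((sigma^-1)%g a)])) /=; last first.
    by move=> t _; apply/ffunP => a; rewrite !ffunE permK.
  have Ep (t : {ffun 'I_j -> {set 'I_k}}) :
      part I [ffun a => t (sigma a)] = part I t.
    rewrite -(part_perm I t sigma); apply: eq_forallb => x.
    by congr (_ == _); apply: eq_bigr => a _; rewrite ffunE.
  apply: eq_big => [t|t /andP[]].
    rewrite Ep -[RHS]andbT; congr (_ && _).
    by apply/eqP/ffunP => a; rewrite !ffunE permKV.
  rewrite Ep => pt _; rewrite -(part_sign_perm sigma pt); congr (_ *: F _).
    by apply: eq_bigr => a _; apply: eq_bigr => b _; rewrite !ffunE.
  by apply: eq_map => a; rewrite ffunE.
under [RHS]eq_bigr => t _ do rewrite mulrC -scalerA scaler_sumr.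
rewrite -scaler_sumr exchange_big /=.
apply: (scalerI nz); rewrite scalerA mulfV // scale1r.
rewrite scaler_nat -[in LHS](card_Sn j) -sumr_const; apply: eq_bigr => sigma _.
by rewrite {1}(E sigma); apply: eq_bigr => t _; rewrite scalerA.
Qed.

Lemma part_card s I (t : 'I_s -> {set 'I_k}) : part I t ->
  (\sum_(a < s) #|t a| = #|I|)%N.
Proof.
move=> pt; rewrite -sum1_card (part_big _ _ pt).
by apply: eq_bigr => a _; rewrite sum1_card.
Qed.

(** More blocks than points force an empty block. *)
Lemma psum_too_many (V : lmodType rat) j I (F : seq {set 'I_k} -> V) :
  (forall t, size t = j -> set0 \in t -> F t = 0) -> (#|I| < j)%N -> psum d j I F = 0.
Proof.
move=> F0 Ij; rewrite psum_partE big1 // => t pt.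
have [/existsP[a /eqP ta]|] := boolP [exists a, t a == set0].
  rewrite F0 ?scaler0 ?size_map -?enumT ?size_enum_ord //.
  by apply/mapP; exists a; rewrite ?mem_enum.
rewrite negb_exists => /forallP tn; move: Ij; rewrite -(part_card pt).
have : (\sum_(a < j) 1 <= \sum_(a < j) #|t a|)%N.
  by apply: leq_sum => a _; rewrite card_gt0.
by rewrite sum1_card card_ord ltnNge => ->.
Qed.

(** A partition of k points into k nonempty blocks is a permutation. *)
Lemma psum_singletons (V : lmodType rat) (F : seq {set 'I_k} -> V) :
  (forall t, size t = k -> set0 \in t -> F t = 0) ->
  psum d k [set: 'I_k] F = \sum_(sigma : 'S_k)
    koszul (fun a => d a + 1) sigma *: F [seq [set sigma a] | a <- enum 'I_k].
Proof.
move=> F0; rewrite psum_partE.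
rewrite (bigID (fun t : {ffun 'I_k -> {set 'I_k}} => [forall a, t a != set0])) /=.
rewrite [X in _ + X]big1 ?addr0; last first.
  move=> t /andP[_]; rewrite negb_forall => /existsP[a]; rewrite negbK => /eqP ta.
  rewrite F0 ?scaler0 ?size_map -?enumT ?size_enum_ord //.
  by apply/mapP; exists a; rewrite ?mem_enum.
pose sing (sigma : 'S_k) : {ffun 'I_k -> {set 'I_k}} := [ffun a => [set sigma a]].
have sing_inj : injective sing.
  by move=> s1 s2 /ffunP E; apply/permP => a; have := E a; rewrite !ffunE => /set1_inj.
have psing sigma : part [set: 'I_k] (sing sigma).
  apply/forallP => x; rewrite inE (bigD1 ((sigma^-1)%g x)) //= ffunE inE permKV eqxx.
  rewrite big1 // => a ax; rewrite ffunE inE; case: eqP => // E.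
  by rewrite E permK eqxx in ax.
rewrite (eq_bigl [in [set sing sigma | sigma in [set: 'S_k]]]); last first.
  move=> t; apply/andP/imsetP => [[pt /forallP tn]|[sigma _ ->]]; last first.
    by split=> //; apply/forallP => a; rewrite ffunE; apply/set0Pn; exists (sigma a); rewrite inE.
  have t1 a : #|t a| = 1%N.
    have := part_card pt; rewrite cardsT card_ord => ct.
    have ge1 b : (0 < #|t b|)%N by rewrite card_gt0.
    have := leqif_sum (fun b (_ : true) => conj (ge1 b) (erefl (1 == #|t b|)%N)).
    rewrite ct sum1_card card_ord => -[_]; rewrite eqxx => /esym/forallP/(_ a)/=.
    by rewrite eq_sym => /eqP.
  pose g a := odflt a [pick x in t a].
  have tg a : t a = [set g a].
    have /cards1P[x E] : #|t a| == 1%N by rewrite t1.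
    rewrite /g; case: pickP => [y|/(_ x)]; rewrite E inE ?eqxx //.
    by move=> /eqP ->.
  have ginj : injective g.
    move=> a b E; apply/eqP/negP => /negP/(part_disjoint pt).
    by rewrite !tg E -setI_eq0 setIid => /eqP/setP/(_ (g b)); rewrite !inE eqxx.
  by exists (perm ginj); rewrite ?inE //; apply/ffunP => a; rewrite ffunE permE tg.
rewrite big_imset /=; last by move=> s1 s2 _ _; apply: sing_inj.
apply: eq_big => [sigma|sigma _]; first by rewrite inE.
have -> : part_sign (sing sigma) = koszul (fun a => d a + 1) sigma.
  pose t1 (a : 'I_k) := [set a].
  have pt1 : part [set: 'I_k] t1.
    apply/forallP => x; rewrite inE (bigD1 x) //= inE eqxx big1 // => a ax.
    by rewrite inE eq_sym (negPf ax).
  transitivity (part_sign (fun a => t1 (sigma a))).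
    by apply: eq_bigr => a _; apply: eq_bigr => b _; rewrite !ffunE.
  rewrite (part_sign_perm sigma pt1) /part_sign big1 ?mul1r; last first.
    move=> a _; rewrite big1 // => b ab; rewrite /kap big_set1 big_pred0 // => c.
    by rewrite inE; case: eqP => //= ->; rewrite ltnNge (ltnW ab).
  apply: eq_bigr => a _; apply: eq_bigr => b _.
  by rewrite !udeg1_sum !big_set1.
by congr (_ *: F _); apply: eq_map => a; rewrite ffunE.
Qed.

End PartitionFunctions.

(** * Counting planar drawings *)

(** The number of isomorphisms between the underlying rooted trees. *)
Fixpoint iso_count (T T' : btree) : nat :=
  match T, T' with
  | Leaf, Leaf => 1
  | Node A B, Node C D =>
      (iso_count A C * iso_count B D + iso_count A D * iso_count B C)%N
  | _, _ => 0
  end.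

Lemma iso_count_gt0 T T' : (0 < iso_count T T')%N = tree_iso T T'.
Proof.
elim: T T' => [|A IHA B IHB] [|C D] //=.
by rewrite addn_gt0 !muln_gt0 !IHA !IHB.
Qed.

Lemma iso_countC T T' : iso_count T T' = iso_count T' T.
Proof.
elim: T T' => [|A IHA B IHB] [|C D] //=.
by rewrite IHA IHB (IHA D) (IHB C) (mulnC (iso_count D A)).
Qed.

Lemma iso_count_iso T T' U : tree_iso T T' -> iso_count T U = iso_count T' U.
Proof.
elim: T T' U => [|A IHA B IHB] [|A' B'] [|C D] //= /orP[] /andP[iA iB].
  by rewrite !(IHA A') // !(IHB B').
by rewrite !(IHA B') // !(IHB A') // addnC mulnC (mulnC (iso_count B' C)).
Qed.

Lemma iso_count_self T T' : tree_iso T T' -> iso_count T T' = iso_count T T.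
Proof. by move=> i; rewrite [RHS](iso_count_iso _ i) iso_countC. Qed.

Lemma tree_isoC T T' : tree_iso T T' = tree_iso T' T.
Proof. by rewrite -!iso_count_gt0 iso_countC. Qed.

Lemma tree_iso_trans T U T' : tree_iso T U -> tree_iso U T' -> tree_iso T T'.
Proof. by move=> i; rewrite -!iso_count_gt0 (iso_count_iso _ i). Qed.

Lemma tree_iso_leaves T T' : tree_iso T T' -> leaves T = leaves T'.
Proof.
elim: T T' => [|A IHA B IHB] [|C D] //= /orP[] /andP[/IHA -> /IHB ->] //.
exact: addnC.
Qed.

(** A drawing of T together with an isomorphism from T amounts to choosing the order
    of the two branches at each of the (leaves T).-1 vertices. *)
Lemma sum_iso_count T m : (leaves T <= m.+1)%N ->
  (\sum_(T' <- trees_upto m) iso_count T T' = 2 ^ (leaves T).-1)%N.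
Proof.
elim: T m => [|A IHA B IHB] m /=.
  move=> _; case: m => [|m] /=; first by rewrite big_seq1.
  by rewrite big_cons big_allpairs_dep /= big1 // => C _; rewrite big1.
case: m => [|m] Tm.
  by have := leaves_gt0 A; have := leaves_gt0 B; lia.
rewrite /= big_cons big_allpairs_dep /= add0n.
under eq_bigr => C _ do rewrite big_split /= -big_distrr -big_distrl /=.
rewrite big_split /= -big_distrl -big_distrr /= !IHA ?IHB;
  try by have := leaves_gt0 A; have := leaves_gt0 B; lia.
rewrite addnn -muln2 -expnD -expnSr; congr (_ ^ _)%N.
by have := leaves_gt0 A; have := leaves_gt0 B; lia.
Qed.

(** Every vertex is reached from the root along edges. *)
Lemma vertex_ind T (P : vertex T -> Prop) :
  P (Defs.root T) -> (forall u v, edge u v -> P u -> P v) -> forall v, P v.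
Proof.
elim: T P => [|A IHA B IHB] P P0 PS; first by case.
case=> [[x|y]|] //.
  apply: (IHA (fun x => P (Some (inl x)))) => [|u v uv]; last exact: PS.
  by apply: (PS None) => //=; rewrite eqxx.
apply: (IHB (fun x => P (Some (inr x)))) => [|u v uv]; last exact: PS.
by apply: (PS None) => //=; rewrite eqxx.
Qed.

(** Equal numbers of vertices make the injections bijective. *)
Definition tree_isos T T' : {set {ffun vertex T -> vertex T'}} :=
  [set f : {ffun vertex T -> vertex T'} | [&& f (Defs.root T) == Defs.root T', injectiveb f,
     #|vertex T| == #|vertex T'| &
     [forall u, forall v, edge (f u) (f v) == edge u v]]].

Lemma tree_isosP T T' (f : {ffun vertex T -> vertex T'}) :
  reflect [/\ f (Defs.root T) = Defs.root T', injective f, #|vertex T| = #|vertex T'|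
            & forall u v, edge (f u) (f v) = edge u v]
          (f \in tree_isos T T').
Proof.
rewrite inE; apply: (iffP and4P) => [] [/eqP f0 /injectiveP fi /eqP c fe]; split => //.
  by move=> u v; have /forallP/(_ u)/forallP/(_ v)/eqP := fe.
by apply/forallP => u; apply/forallP => v; rewrite fe.
Qed.

Lemma card_tree_aut_isos T : #|tree_aut T| = #|tree_isos T T|.
Proof.
pose val_perm (s : {perm vertex T}) : {ffun vertex T -> vertex T} := pval s.
have E s u : val_perm s u = s u by rewrite unlock.
rewrite -(card_imset _ (_ : injective val_perm)); last exact: val_inj.
apply: eq_card => f; apply/imsetP/tree_isosP => [[s]|[f0 fi _ fe]].
  rewrite inE => /andP[/eqP s0 /forallP se] ->; split => //; rewrite ?E //.
    by move=> u v; rewrite !E => /perm_inj.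
  by move=> u v; rewrite !E; have /forallP/(_ v)/eqP := se u.
exists (perm fi); last by apply/ffunP => u; rewrite E permE.
rewrite inE permE f0 eqxx; apply/forallP => u; apply/forallP => v.
by rewrite !permE fe.
Qed.

Section GlueIsos.
Variables A B : btree.

Definition swap_branches C D (u : vertex (Node D C)) : vertex (Node C D) :=
  match u with
  | None => None
  | Some (inl x) => Some (inr x)
  | Some (inr y) => Some (inl y)
  end.

Lemma swap_branchesK C D : cancel (@swap_branches C D) (@swap_branches D C).
Proof. by case=> [[x|y]|]. Qed.

Lemma edge_swap C D u v : edge (@swap_branches C D u) (swap_branches v) = edge u v.
Proof. by case: u v => [[x|y]|] [[x'|y']|]. Qed.

(** Testing where the root of the left branch goes is enough, by [left_isosE]. *)
Definition left_isos C D :=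
  [set h in tree_isos (Node A B) (Node C D) |
     if h (Some (inl (Defs.root A))) is Some (inl _) then true else false].

Definition glue C D (f : {ffun vertex A -> vertex C} * {ffun vertex B -> vertex D}) :
    {ffun vertex (Node A B) -> vertex (Node C D)} :=
  [ffun u : vertex (Node A B) =>
     (match u with
      | None => None
      | Some (inl x) => Some (inl (f.1 x))
      | Some (inr y) => Some (inr (f.2 y))
      end) : vertex (Node C D)].

Lemma glue_inj C D : injective (@glue C D).
Proof.
move=> [f g] [f' g'] /ffunP E; congr (_, _); apply/ffunP => x.
  by have := E (Some (inl x)); rewrite !ffunE => -[].
by have := E (Some (inr x)); rewrite !ffunE => -[].
Qed.

Lemma card_node T T' : #|vertex (Node T T')| = (#|vertex T| + #|vertex T'|).+1.
Proof. by rewrite card_option card_sum. Qed.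

(** An isomorphism preserves the root and the edges, hence maps everything reached
    from the root of a branch into the branch where this root goes. *)
Lemma left_isosE C D :
  left_isos C D = [set glue f | f in setX (tree_isos A C) (tree_isos B D)].
Proof.
apply/setP => h; apply/idP/imsetP => [|[[f g]]]; last first.
  rewrite inE /= => /andP[/tree_isosP[f0 fi fc fe] /tree_isosP[g0 gi gc ge]] ->.
  rewrite inE ffunE andbT; apply/tree_isosP; split.
  - by rewrite ffunE.
  - move=> [[x|y]|] [[x'|y']|]; rewrite !ffunE //= => -[]; [by move=> /fi ->|by move=> /gi ->].
  - by rewrite !card_node fc gc.
  by move=> [[x|y]|] [[x'|y']|]; rewrite !ffunE //= -?f0 -?g0 ?(inj_eq fi) ?(inj_eq gi).
rewrite inE => /andP[/tree_isosP[h0 hi hc he]].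
case hA: (h (Some (inl (Defs.root A)))) => [[c0|]|] // _.
have hAroot : c0 = Defs.root C.
  have := he None (Some (inl (Defs.root A))); rewrite h0 hA /= !eqxx.
  by move/eqP.
have hB : h (Some (inr (Defs.root B))) = Some (inr (Defs.root D)).
  have := he None (Some (inr (Defs.root B))); rewrite h0 /= eqxx.
  case hB: (h _) => [[c|e]|] //= /eqP E; last by rewrite E.
  by move: hB; rewrite E -hAroot -hA => /hi.
pose f : {ffun vertex A -> vertex C} :=
  [ffun x => if h (Some (inl x)) is Some (inl c) then c else Defs.root C].
pose g : {ffun vertex B -> vertex D} :=
  [ffun y => if h (Some (inr y)) is Some (inr e) then e else Defs.root D].
have hf x : h (Some (inl x)) = Some (inl (f x)).
  rewrite ffunE; move: x; apply: vertex_ind => [|u v uv]; first by rewrite hA.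
  case: (h (Some (inl u))) (he (Some (inl u)) (Some (inl v))) => [[c|]|] //= E _.
  by move: E; rewrite uv; case: (h (Some (inl v))) => [[]|].
have hg y : h (Some (inr y)) = Some (inr (g y)).
  rewrite ffunE; move: y; apply: vertex_ind => [|u v uv]; first by rewrite hB.
  case: (h (Some (inr u))) (he (Some (inr u)) (Some (inr v))) => [[|c]|] //= E _.
  by move: E; rewrite uv; case: (h (Some (inr v))) => [[]|].
have fi : injective f by move=> u v E; apply/eqP; have := hf u; rewrite E -hf => /hi[->].
have gi : injective g by move=> u v E; apply/eqP; have := hg u; rewrite E -hg => /hi[->].
have := leq_card f fi; have := leq_card g gi; rewrite !card_node in hc => cg cf.
exists (f, g); last by apply/ffunP => -[[x|y]|]; rewrite ffunE ?h0 ?hf ?hg.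
rewrite inE /=; apply/andP; split; apply/tree_isosP; split => //.
- by have := hf (Defs.root A); rewrite hA hAroot => -[].
- by move: cg cf hc; lia.
- by move=> u v; have := he (Some (inl u)) (Some (inl v)); rewrite !hf.
- by have := hg (Defs.root B); rewrite hB => -[].
- by move: cg cf hc; lia.
by move=> u v; have := he (Some (inr u)) (Some (inr v)); rewrite !hg.
Qed.

Definition swap_iso C D (h : {ffun vertex (Node A B) -> vertex (Node C D)}) :
    {ffun vertex (Node A B) -> vertex (Node D C)} := [ffun u => swap_branches (h u)].

Lemma swap_isoK C D : cancel (@swap_iso C D) (@swap_iso D C).
Proof. by move=> h; apply/ffunP => u; rewrite !ffunE swap_branchesK. Qed.

Lemma swap_iso_isos C D h :
  h \in tree_isos (Node A B) (Node C D) -> @swap_iso C D h \in tree_isos (Node A B) (Node D C).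
Proof.
move=> /tree_isosP[h0 hi hc he]; apply/tree_isosP; split.
- by rewrite ffunE h0.
- by move=> u v; rewrite !ffunE => /(can_inj (@swap_branchesK _ _))/hi.
- by rewrite hc !card_node addnC.
by move=> u v; rewrite !ffunE edge_swap he.
Qed.

Lemma left_swap_iso C D h : h \in tree_isos (Node A B) (Node C D) ->
  (@swap_iso C D h \in left_isos D C) = (h \notin left_isos C D).
Proof.
move=> hT; rewrite [in LHS]in_set [in RHS]in_set hT swap_iso_isos // ffunE /=.
case/tree_isosP: hT => h0 _ _ /(_ None (Some (inl (Defs.root A)))).
by rewrite h0 /= eqxx; case: (h _) => [[]|].
Qed.

Lemma card_tree_isos_node C D : #|tree_isos (Node A B) (Node C D)| =
  (#|tree_isos A C| * #|tree_isos B D| + #|tree_isos A D| * #|tree_isos B C|)%N.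
Proof.
rewrite -!cardsX -!(card_imset _ (@glue_inj _ _)) -!left_isosE.
rewrite -(cardsID (left_isos C D)); congr (_ + _)%N.
  by congr #|pred_of_set _|; apply/setIidPr/subsetP => h; rewrite inE => /andP[].
rewrite -(card_imset _ (can_inj (@swap_isoK C D))); congr #|pred_of_set _|.
apply/setP => h'; apply/imsetP/idP => [[h /setDP[hT nl] ->]|h'L].
  by rewrite left_swap_iso.
have h'T : h' \in tree_isos (Node A B) (Node D C) by move: h'L; rewrite in_set => /andP[].
exists (swap_iso h'); last by rewrite swap_isoK.
apply/setDP; split; first exact: swap_iso_isos.
by rewrite left_swap_iso // negbK.
Qed.

End GlueIsos.

Lemma card_vertex_gt0 T : (0 < #|vertex T|)%N.
Proof. by apply/card_gt0P; exists (Defs.root T). Qed.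

Lemma card_tree_isos T T' : #|tree_isos T T'| = iso_count T T'.
Proof.
elim: T T' => [|A IHA B IHB] [|C D]; last by rewrite card_tree_isos_node !IHA !IHB.
- apply/eqP/cards1P; exists [ffun u : vertex Leaf => u : vertex Leaf].
  apply/setP => f; rewrite [RHS]in_set1; apply/tree_isosP/eqP => [_|->].
    by apply/ffunP => -[]; rewrite ffunE; case: (f tt).
  by split=> //; rewrite ?ffunE // => -[] [].
- apply: eq_card0 => f; apply/negbTE/negP => /tree_isosP[_ _ hc _].
  by move: hc (card_vertex_gt0 C); rewrite card_node /= card_unit => -[]; case: #|_|.
apply: eq_card0 => f; apply/negbTE/negP => /tree_isosP[_ _ hc _].
by move: hc (card_vertex_gt0 A); rewrite card_node /= card_unit => -[]; case: #|_|.
Qed.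

Lemma card_tree_aut T : #|tree_aut T| = iso_count T T.
Proof. by rewrite card_tree_aut_isos card_tree_isos. Qed.

(** Each planar tree with j leaves is a drawing of exactly one T in ts, and T has
    2 ^ (j - 1) / |Aut T| drawings. *)
Lemma sum_drawing (V : lmodType rat) (f : btree -> V) j ts m :
  (forall T T', tree_iso T T' -> f T = f T') -> drawing j ts -> (j <= m.+1)%N ->
  \sum_(T <- ts) (#|tree_aut T|%:R : rat)^-1 *: f T =
  2%:R ^- j.-1 *: \sum_(T <- trees_upto m | leaves T == j) f T.
Proof.
move=> f_iso [/allP ts_leaves ts_pair ts_has] jm.
have fE T' : leaves T' = j ->
    f T' = \sum_(T <- ts) ((iso_count T T')%:R / (iso_count T T)%:R : rat) *: f T.
  move=> /ts_has; elim: ts ts_pair {ts_leaves ts_has} => //= T ts IHts /andP[/allP nT pts].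
  rewrite big_cons; have [iT _|niT /=] := boolP (tree_iso T' T).
    rewrite [X in _ + X]big_seq big1 ?addr0.
      rewrite tree_isoC in iT; rewrite (iso_count_self iT) mulfV ?scale1r.
        exact/esym/f_iso.
      by rewrite pnatr_eq0 -lt0n iso_count_gt0 (tree_iso_trans iT) // tree_isoC.
    move=> T1 /nT nTT1; suff -> : iso_count T1 T' = 0%N by rewrite mul0r scale0r.
    apply/eqP; rewrite -leqn0 leqNgt iso_count_gt0; apply: contra nTT1 => i1.
    by rewrite tree_isoC (tree_iso_trans i1).
  move=> /(IHts pts) ->; suff -> : iso_count T T' = 0%N by rewrite mul0r scale0r add0r.
  by apply/eqP; rewrite -leqn0 leqNgt iso_count_gt0 tree_isoC.
rewrite [X in _ = _ *: X](eq_bigr _ (fun T' jT' => fE T' (eqP jT'))) exchange_big.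
rewrite scaler_sumr big_seq [RHS]big_seq; apply: eq_bigr => T /ts_leaves/eqP Tj /=.
rewrite -scaler_suml scalerA card_tree_aut -mulr_suml -natr_sum mulrA; congr (_ *: _).
suff -> : (\sum_(T' <- trees_upto m | leaves T' == j) iso_count T T' = 2 ^ j.-1)%N.
  by rewrite natrX mulVf ?mul1r // expf_neq0 // pnatr_eq0.
rewrite -Tj -(@sum_iso_count T m) ?Tj // [RHS](bigID (fun T' => leaves T' == j)) /=.
rewrite [X in (_ + X)%N]big1 ?addn0 // => T'; rewrite -Tj => ne.
apply/eqP; rewrite -leqn0 leqNgt iso_count_gt0; apply: contra ne => /tree_iso_leaves ->.
exact: eqxx.
Qed.

(** * Transferred brackets as sums over planar trees *)

Lemma signz_natmul n (x : int) : signz (x * n%:Z) = signz x ^+ n.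
Proof.
elim: n => [|n IHn]; first by rewrite mulr0 signz0 expr0.
by rewrite -addn1 PoszD mulrDr mulr1 signzM IHn addn1 exprSr.
Qed.

Lemma thetaE k (d : 'I_k -> int) :
  theta d = signz (\sum_(i < k | (i.+1 < k)%N) (k - i.+1)%N%:Z * d i).
Proof.
rewrite signz_sum [RHS]big_mkcond; apply: eq_bigr => a _.
have -> : \prod_(b < k | (a < b)%N) signz (d a) = signz (d a) ^+ (k - a.+1).
  rewrite -prodr_const_nat (big_nat_widenl _ 0) // big_mkord.
  by apply: eq_bigl => b.
rewrite mulrC signz_natmul; case: ltnP => // ka.
by move/eqP: ka => ->; rewrite expr0.
Qed.

Lemma seq_theta_enum (L : dgLieType) s (e : 'I_s -> int) (y : 'I_s -> homology L) :
  seq_theta [seq (e a, y a) | a <- enum 'I_s] = theta e.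
Proof.
elim: s e y => [|s IHs] e y.
  have -> : enum 'I_0 = [::] by apply: size0nil; rewrite size_enum_ord.
  by rewrite /theta big_ord0.
rewrite enum_ordSl /= -map_comp size_map size_enum_ord.
rewrite (IHs (fun a => e (lift ord0 a)) (fun a => y (lift ord0 a))).
rewrite /theta [RHS]big_ord_recl; congr (_ * _).
  rewrite big_mkcond big_ord_recl /= mul1r prodr_const card_ord.
  exact: signz_natmul.
apply: eq_bigr => a _; rewrite [RHS]big_mkcond big_ord_recl /= mul1r big_mkcond.
by apply: eq_bigr => b _.
Qed.

Lemma stree_zero (L : dgLieType) (r : homotopy_retract L) T w v :
  size w = leaves T -> v \in w -> v.2 = 0 -> stree r T w = 0.
Proof.
elim: T w => [|A IHA B IHB] w /=.
  by case: w => [|v' [|]] //= _; rewrite inE => /eqP <- ->; rewrite linear0.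
move=> sw; have sA : size (take (leaves A) w) = leaves A.
  by rewrite size_takel // sw leq_addr.
have sB : size (drop (leaves A) w) = leaves B by rewrite size_drop sw addKn.
rewrite -{1}(cat_take_drop (leaves A) w) mem_cat => /orP[vw|vw] v0.
  by rewrite (IHA _ sA vw v0) linear0 lbr0l scaler0.
by rewrite (IHB _ sB vw v0) !linear0.
Qed.

Section TransferredBrackets.
Variables (L : dgLieType) (r : homotopy_retract L).

Section OneBracket.
Variables (k : nat) (d : 'I_k -> int).
Implicit Types (v : 'I_k -> homology L) (X : {set 'I_k}).

(** The element of H (x) E with coefficient v a at e_a; evaluating a tree with k leaves
    on it gives the signed sum over all ways to put v_1, ..., v_k on the leaves. *)
Definition singleton_family v X : homology L := \sum_(a | X == [set a]) v a.

Lemma singleton_family1 v a : singleton_family v [set a] = v a.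
Proof.
rewrite /singleton_family (big_pred1 a) // => b /=.
by apply/eqP/eqP => [/set1_inj|->].
Qed.

Lemma singleton_family0 v : singleton_family v set0 = 0.
Proof.
apply: big_pred0 => a; apply/negbTE; rewrite eq_sym; apply/set0Pn.
by exists a; rewrite inE.
Qed.

Lemma udeg_set1 a : udeg d [set a] = d a.
Proof. by rewrite /udeg big_set1 addrK. Qed.

Lemma homog_singleton_family v X : (forall a, homog (d a) (v a)) ->
  homog (udeg d X) (singleton_family v X).
Proof.
by move=> hv; apply: homog_sum => a /eqP ->; rewrite udeg_set1.
Qed.

(** With as many leaves as points, all blocks are singletons or some block is empty. *)
Lemma tree_conv_full (h : {set 'I_k} -> homology L) T : h set0 = 0 -> leaves T = k ->
  tree_conv d r h T [set: 'I_k] = \sum_(sigma : 'S_k) koszul (fun a => d a + 1) sigma *: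
    stree r T [seq (d (sigma a), h [set sigma a]) | a <- enum 'I_k].
Proof.
move=> h0 Tk; rewrite tree_conv_psum Tk psum_singletons.
  apply: eq_bigr => sigma _; rewrite -map_comp; congr (_ *: stree _ _ _).
  by apply: eq_map => a /=; rewrite udeg_set1.
move=> t tk t0; apply: (@stree_zero _ _ _ _ (udeg d set0, h set0)).
- by rewrite size_map tk Tk.
- by apply/mapP; exists set0.
exact: h0.
Qed.

(** Desuspension turns the signs of the transferred bracket into the Koszul signs of
    the shifted degrees; the bracket is then the evaluation of all trees on the
    family supported on singletons. *)
Lemma theta_ell ts v : (2 <= k)%N -> drawing k ts ->
  theta d *: ell r ts d v = \sum_(T <- ts) (#|tree_aut T|%:R : rat)^-1 *:
    hr_q r (tree_conv d r (singleton_family v) T [set: 'I_k]).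
Proof.
move=> k2 [/allP ts_leaves _ _]; rewrite /ell ltnNge k2 /= scaler_sumr.
rewrite big_seq [RHS]big_seq; apply: eq_bigr => T /ts_leaves/eqP Tk.
rewrite tree_conv_full ?singleton_family0 // scalerA mulrC -scalerA; congr (_ *: _).
rewrite (linear_sum (hr_q r)) scaler_sumr; apply: eq_bigr => sigma _.
rewrite tree_map_stree ?size_map -?enumT ?size_enum_ord ?Tk //.
rewrite (seq_theta_enum (fun a => d (sigma a)) (fun a => v (sigma a))).
rewrite !(linearZ_LR (hr_q r)) !scalerA -mulrA decalage mulrA thetaK mul1r.
congr (_ *: hr_q r (stree _ _ _)); apply: eq_map => a.
by rewrite singleton_family1.
Qed.

Lemma theta_ell_planar ts v m : (2 <= k <= m.+1)%N -> drawing k ts ->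
  (forall a, homog (d a) (v a)) ->
  theta d *: ell r ts d v =
  2%:R ^- k.-1 *: \sum_(T <- trees_upto m | leaves T == k)
    \sum_(sigma : 'S_k) koszul (fun a => d a + 1) sigma *:
      hr_q r (stree r T [seq (d (sigma a), v (sigma a)) | a <- enum 'I_k]).
Proof.
move=> /andP[k2 km] dts hv; rewrite theta_ell //.
pose f T := hr_q r (tree_conv d r (singleton_family v) T [set: 'I_k]).
rewrite (@sum_drawing _ f k ts m) //; last first.
  move=> T T' iT; rewrite /f (tree_conv_iso r _ iT) // => X.
  exact: homog_singleton_family.
congr (_ *: _); apply: eq_bigr => T /eqP Tk.
rewrite /f tree_conv_full ?singleton_family0 // linear_sum; apply: eq_bigr => sigma _.
rewrite linearZ_LR; congr (_ *: hr_q r (stree _ _ _)); apply: eq_map => a.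
by rewrite singleton_family1.
Qed.

(** Exactly one leaf gets the block that contains a0. *)
Lemma tree_conv_scale (c : rat) (a0 : 'I_k) (h : {set 'I_k} -> homology L) T I :
  tree_conv d r (fun X => (if a0 \in X then c else 1) *: h X) T I =
  (if a0 \in I then c else 1) *: tree_conv d r h T I.
Proof.
elim: T I => [|A IHA B IHB] I /=; first by rewrite linearZ_LR.
rewrite /conv scaler_sumr; apply: eq_bigr => X XI.
rewrite IHA IHB !(linearZ_LR (branch _ _)) lbrZl (linearZ_LR (lbr _)) !scalerA.
congr (_ *: _); have := subsetP XI a0; rewrite inE.
by case: (a0 \in X) => [/(_ isT) ->|_] /=; case: (a0 \in I); ring.
Qed.

(** Absorbs a coefficient into a value of a bracket, whose arguments are all that
    [im_ell] lets vary. *)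
Definition scale_first (c : rat) v (a : 'I_k) : homology L :=
  (if a == 0%N :> nat then c else 1) *: v a.

Lemma ell_scale ts v c : drawing k ts -> c *: ell r ts d v = ell r ts d (scale_first c v).
Proof.
have [k2 _|k2 dts] := ltnP k 2; first by rewrite /ell k2 scaler0.
pose a0 : 'I_k := Ordinal (ltnW k2).
have key T : hr_q r (tree_conv d r (singleton_family (scale_first c v)) T [set: 'I_k]) =
    c *: hr_q r (tree_conv d r (singleton_family v) T [set: 'I_k]).
  have := tree_conv_scale c a0 (singleton_family v) T [set: 'I_k]; rewrite inE.
  rewrite -(linearZ_LR (hr_q r)) => <-; congr (hr_q r _).
  have E X : singleton_family (scale_first c v) X =
      (if a0 \in X then c else 1) *: singleton_family v X.
    rewrite /singleton_family scaler_sumr; apply: eq_bigr => a /eqP ->.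
    by rewrite inE /scale_first -val_eqE eq_sym.
  elim: T [set: 'I_k] => [|A IHA B IHB] I /=; first by rewrite E.
  by apply: eq_bigr => X _; rewrite IHA IHB.
have inj : injective ( *:%R (theta d) : homology L -> homology L).
  by apply: (can_inj (g := *:%R (theta d))) => y; rewrite scalerA thetaK scale1r.
apply: inj; rewrite scalerA mulrC -scalerA !theta_ell // scaler_sumr.
by apply: eq_bigr => T _; rewrite key !scalerA mulrC.
Qed.

End OneBracket.

Lemma im_ell_span k ts (J : finType) (P : pred J) (c : J -> rat)
    (D : J -> 'I_k -> int) (w : J -> 'I_k -> homology L) :
  drawing k ts -> (forall t a, P t -> homog (D t a) (w t a)) ->
  im_ell r ts k (\sum_(t | P t) c t *: ell r ts (D t) (w t)).
Proof.
move=> dts hw.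
exists #|P|, (fun m => D (enum_val m)), (fun m => scale_first (c (enum_val m)) (w (enum_val m))).
split=> [m a|]; first by apply/homogZ/hw; have := enum_valP m.
rewrite big_enum_val; apply: eq_bigr => m _; exact: ell_scale.
Qed.

End TransferredBrackets.

(** * Transfer of a Maurer-Cartan family *)

(** For a cycle z the homotopy identity makes z - i q z the boundary of K z. *)
Lemma hr_q_class (L : dgLieType) (r : homotopy_retract L) (z : Defs.cycle L) :
  hr_q r (cval z) = hclass z.
Proof.
have iq : hr_i r (hr_q r (cval z)) \in @cycle_pred L by rewrite inE hr_i_chain.
rewrite -[LHS](@hr_i_class _ r _ (Cycle iq)) //; apply/eqP; rewrite eq_sym hclass_eq.
apply/boundaryP; exists (hr_K r (cval z)).
transitivity (cval z - hr_i r (hr_q r (cval z))); first exact: (raddfB val).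
rewrite hr_homotopy.
by case: z {iq} => z /= /eqP ->; rewrite linear0 addr0.
Qed.

Section Decomposition.
Variables (k : nat) (d : 'I_k -> int) (L : dgLieType) (r : homotopy_retract L).
Variable h : {set 'I_k} -> homology L.
Hypotheses (h0 : h set0 = 0) (hh : forall X, homog (udeg d X) (h X)).

(** The contribution of the trees with j leaves to q (1/2 (a, a)) at the full set. *)
Definition leaf_part j : homology L :=
  2%:R ^- j.-1 *: \sum_(T <- trees_upto k.+1 | leaves T == j)
     hr_q r (tree_conv d r h T [set: 'I_k]).

Lemma leaf_part_top ts : (2 <= k)%N -> drawing k ts ->
  leaf_part k = theta d *: ell r ts d (fun a => h [set a]).
Proof.
move=> k2 dts; rewrite (theta_ell_planar r (m := k.+1) _ dts).
- congr (_ *: _); apply: eq_bigr => T /eqP Tk.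
  by rewrite tree_conv_full // linear_sum; apply: eq_bigr => sigma _; rewrite linearZ_LR.
- by rewrite k2 -addn2 leq_addr.
by move=> a; rewrite -(udeg_set1 d).
Qed.

(** For a partition t into j blocks, the sum over the reorderings of its blocks and
    over the trees is ell_j on the h (t a), up to sign. *)
Lemma leaf_partE j ts : (2 <= j <= k)%N -> drawing j ts ->
  leaf_part j = \sum_(t : {ffun 'I_j -> {set 'I_k}} | part [set: 'I_k] t)
    (part_sign d t / j`!%:R * theta (fun a => udeg d (t a))) *:
       ell r ts (fun a => udeg d (t a)) (fun a => h (t a)).
Proof.
move=> /andP[j2 jk] dts.
have jm : (2 <= j <= k.+2)%N by rewrite j2 !leqW.
under [RHS]eq_bigr => t _ do
  rewrite -scalerA (theta_ell_planar r (m := k.+1) jm dts (fun a => hh (t a))).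
have E T : leaves T == j -> hr_q r (tree_conv d r h T [set: 'I_k]) =
    \sum_(t : {ffun 'I_j -> {set 'I_k}} | part [set: 'I_k] t)
      (part_sign d t / j`!%:R) *: \sum_(sigma : 'S_j)
        koszul (fun a => udeg d (t a) + 1) sigma *: hr_q r (stree r T
          [seq (udeg d (t (sigma a)), h (t (sigma a))) | a <- enum 'I_j]).
  move=> /eqP Tj; rewrite tree_conv_psum Tj psum_average (linear_sum (hr_q r)).
  apply: eq_bigr => t _; rewrite (linearZ_LR (hr_q r)) (linear_sum (hr_q r)).
  congr (_ *: _); apply: eq_bigr => sigma _.
  by rewrite (linearZ_LR (hr_q r)) -map_comp.
rewrite /leaf_part (eq_bigr _ E) exchange_big scaler_sumr; apply: eq_bigr => t _ /=.
by rewrite -scaler_sumr !scalerA mulrC.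
Qed.

(** Trees with more than k leaves contribute nothing, as h vanishes at the empty
    block that they must have. *)
Lemma sum_leaf_parts :
  \sum_(S <- [seq Node A B | A <- trees_upto k, B <- trees_upto k])
     tree_weight S *: hr_q r (tree_conv d r h S [set: 'I_k]) =
  \sum_(2 <= j < k.+1) leaf_part j.
Proof.
pose G S := tree_weight S *: hr_q r (tree_conv d r h S [set: 'I_k]).
transitivity (\sum_(S <- trees_upto k.+1 | (1 < leaves S)%N) G S).
  rewrite [RHS]big_mkcond /= big_cons /= add0r !big_allpairs_dep.
  apply: eq_bigr => A _; apply: eq_bigr => B _ /=.
  suff -> : (1 < leaves A + leaves B)%N by [].
  by have := leaves_gt0 A; have := leaves_gt0 B; lia.
have G0 S : (k < leaves S)%N -> G S = 0.
  move=> kS; rewrite /G tree_conv_psum psum_too_many ?linear0 ?cardsT ?card_ord //.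
  move=> t ts t0; apply: (@stree_zero _ _ _ _ (udeg d set0, h set0)) => //.
    by rewrite size_map ts.
  by apply/mapP; exists set0.
transitivity (\sum_(2 <= j < k.+1) \sum_(S <- trees_upto k.+1 | leaves S == j) G S).
  rewrite (exchange_big_dep predT) //= big_mkcond; apply: eq_bigr => S _.
  under eq_bigl => j do rewrite eq_sym.
  rewrite big_nat1_eq; have [S1|_ //] := ltnP 1 (leaves S).
  by case: ltnP => // kS; rewrite G0.
apply: eq_bigr => j _; rewrite /leaf_part scaler_sumr; apply: eq_bigr => S /eqP <-.
by [].
Qed.

End Decomposition.

(** The theorem for an arbitrary Maurer-Cartan family up to the top component; minus
    the curvature at the full set is the obstruction. *)
Lemma maurer_cartan_transfer k (d : 'I_k -> int) (L : dgLieType)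
    (r : homotopy_retract L) (a : {set 'I_k} -> L) (trees : nat -> seq btree) :
  (2 <= k)%N -> (forall j, drawing j (trees j)) ->
  homog_family d a -> a set0 = 0 ->
  (forall J : {set 'I_k}, J \proper [set: 'I_k] -> curvature d a J = 0) ->
  exists2 Gamma : homology L, sum_im_ell r trees k Gamma &
    theta d *: ell r (trees k) d (fun i => hr_q r (a [set i])) =
      - hr_q r (curvature d a [set: 'I_k]) + Gamma.
Proof.
move=> k2 dtrees ha a0 flat.
have [a' [ha' a'0 ca' qa' na']] := normalise r ha a0 flat.
pose h X := hr_q r (a' X).
have h0 : h set0 = 0 by rewrite /h a'0 linear0.
have hh X : homog (udeg d X) (h X) by apply: hr_q_homog; apply: ha'.
have aE (J : {set 'I_k}) : J \proper [set: 'I_k] ->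
    a' J = hr_i r (h J) + hr_K r (2%:R^-1 *: conv d a' a' J).
  move=> JT; have := ca' J; rewrite (flat _ JT) /curvature => /eqP.
  by rewrite subr_eq0 => /eqP <-; apply: na'.
have tE := tree_expansion h0 a'0 aE.
have qc : - hr_q r (curvature d a [set: 'I_k]) = \sum_(2 <= j < k.+1) leaf_part d r h j.
  rewrite -ca' /curvature linearB /= hr_q_chain sub0r opprK -sum_leaf_parts //.
  rewrite (half_conv_trees (r := r) h0 a'0 (ts := trees_upto k)) => [|X XT].
    by rewrite linear_sum; apply: eq_bigr => S _; rewrite linearZ_LR.
  by apply: tE => //; have := proper_card XT; rewrite cardsT card_ord => /ltnW/leqW.
rewrite big_nat_recr // in qc.
have topE : leaf_part d r h k = theta d *: ell r (trees k) d (fun i => hr_q r (a [set i])).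
  rewrite (leaf_part_top r h0 hh k2 (dtrees k)); congr (_ *: _).
  by congr (ell r _ _ _); apply: boolp.funext => i; rewrite /h qa'.
exists (- \sum_(2 <= j < k) leaf_part d r h j); last first.
  by rewrite qc -topE addrAC subrr add0r.
exists (fun j => if (1 < j)%N then - leaf_part d r h j else 0); last first.
  rewrite [RHS]big_ltn //= add0r -sumrN; apply: eq_big_nat => j /andP[-> //].
move=> j /andP[j1 jk]; case: ltnP => j2; last first.
  exists 0%N, (fun _ _ => 0), (fun _ _ => 0); split; first by case.
  by rewrite big_ord0.
rewrite (leaf_partE r hh (_ : 2 <= j <= k)%N (dtrees j)); last by rewrite j2 ltnW.
rewrite -sumrN; under eq_bigr => t _ do rewrite -scaleNr.
have := @im_ell_span L r j (trees j) {ffun 'I_j -> {set 'I_k}}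
  (fun t => part [set: 'I_k] t)
  (fun t => - (part_sign d t / j`!%:R * theta (fun a => udeg d (t a))))
  (fun t a => udeg d (t a)) (fun t a => h (t a)) (dtrees j).
apply.
by move=> t i _; apply: hh.
Qed.

(** * Morphisms out of the free model *)

Section Morphisms.
Variables (k : nat) (d : 'I_k -> int) (L : dgLieType) (phi : {linear whL d -> L}).
Hypothesis phi_lbr : forall y z, phi (lbr y z) = lbr (phi y) (phi z).
Hypothesis phi_diff : forall y, phi (wh_diff y) = ldiff (phi y).

Lemma ugen_default I : ~~ ((I != set0) && (I != [set: 'I_k])) -> ugen d I = 0.
Proof. by move=> nI; rewrite /ugen insubN. Qed.

Lemma phi_wh_rhs I :
  phi (wh_rhs d I) = 2%:R^-1 *: conv d (phi \o ugen d) (phi \o ugen d) I.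
Proof.
rewrite wh_rhs_conv linearZ_LR linear_sum; congr (_ *: _); apply: eq_bigr => X _.
by rewrite linearZ_LR phi_lbr.
Qed.

(** A morphism out of the free model is a Maurer-Cartan family indexed by the proper
    subsets, and the class of its value at omega is the obstruction to extending the
    family to the full set. *)
Lemma curvature_morphism I : curvature d (phi \o ugen d) I =
  if I == [set: 'I_k] then - phi (wh_omega d) else 0.
Proof.
rewrite /curvature -phi_wh_rhs; case: eqP => [->|/eqP IT].
  by rewrite /= ugen_default ?eqxx ?andbF // !linear0 sub0r.
have [->|I0] := eqVneq I set0.
  have u0 : ugen d set0 = 0 by rewrite ugen_default ?eqxx.
  by rewrite /= u0 wh_rhs_conv conv_set0 // scaler0 !linear0 addr0.
have PI : (I != set0) && (I != [set: 'I_k]) by rewrite I0.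
apply/eqP; rewrite subr_eq0 -phi_diff /ugen /= insubT /= /wh_diff fder_fgen /=.
by [].
Qed.

End Morphisms.

Theorem proposition3p1 (L : dgLieType) (k : nat) (hk : (2 <= k)%N)
    (d : 'I_k -> int) (x : 'I_k -> homology L)
    (hx : forall i, homog (d i) (x i))
    (hW : exists h, whitehead d x h)
    (trees : nat -> seq btree) (htrees : forall j, drawing j (trees j))
    (r : homotopy_retract L) :
  (forall h, whitehead d x h ->
     exists2 Gamma : homology L, sum_im_ell r trees k Gamma &
       signz (\sum_(i < k | (i.+1 < k)%N) (k - i.+1)%N%:Z * d i)
         *: ell r (trees k) d x = h + Gamma)
  /\ ((forall j, (1 <= j <= k.-1)%N -> ell_vanishes r (trees j) j) ->
      exists b : bool, whitehead d x ((-1) ^+ b *: ell r (trees k) d x)).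
Proof.
have main h : whitehead d x h ->
     exists2 Gamma : homology L, sum_im_ell r trees k Gamma &
       theta d *: ell r (trees k) d x = h + Gamma.
  case=> phi [phi_homog phi_lbr phi_diff phi_x [z zE <-]].
  have curv := curvature_morphism phi_lbr phi_diff.
  have ha : homog_family d (phi \o ugen d) by move=> X; apply/phi_homog/homog_ugen.
  have a0 : (phi \o ugen d) set0 = 0 by rewrite /= ugen_default ?eqxx // linear0.
  have flat (J : {set 'I_k}) : J \proper [set: 'I_k] -> curvature d (phi \o ugen d) J = 0.
    by rewrite properEneq curv => /andP[/negPf ->].
  have [Gamma GI] := maurer_cartan_transfer r hk htrees ha a0 flat.
  rewrite curv eqxx linearN opprK /= -zE hr_q_class => E; exists Gamma => //; rewrite -E.
  congr (_ *: ell r _ _ _); apply: boolp.funext => i.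
  by have [y yE <-] := phi_x i; rewrite /= -yE hr_q_class.
rewrite -thetaE; split=> // vanish.
have [h hWh] := hW; have [Gamma [g gI GammaE] E] := main h hWh.
have Gamma0 : Gamma = 0.
  rewrite GammaE big_nat big1 // => j /andP[j1 jk].
  have [|n [D [v [hv ->]]]] := gI j; first by rewrite j1.
  rewrite big1 // => m _; apply: vanish; last exact: hv.
  by rewrite j1 -ltnS prednK // (leq_trans _ hk).
have [b thetab] : exists b : bool, theta d = (-1) ^+ b.
  have /eqP := thetaK d; rewrite -expr2 sqrf_eq1 => /orP[] /eqP ->.
    by exists false.
  by exists true.
by exists b; rewrite -thetab E Gamma0 addr0.
Qed.
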